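(* Let $N\ge 1$, $0<s\le 1$ and $1<p<\infty$ be such that $s\,p>N$. For every $\varphi\in \mathcal{W}^{s,p}(\mathbb{R}^N)$ there exist two distinct points $x_0,y_0\in \mathbb{R}^N$ such that \[ [\varphi]_{C^{0,\alpha_{s,p}}(\mathbb{R}^N)}=\frac{|\varphi(x_0)-\varphi(y_0)|}{|x_0-y_0|^{\alpha_{s,p}}}. \]
   Context: For $0<s<1$, $[\varphi]_{W^{s,p}(\mathbb{R}^N)}=\left(\iint_{\mathbb{R}^N\times\mathbb{R}^N}\frac{|\varphi(x)-\varphi(y)|^p}{|x-y|^{N+s\,p}}dx\,dy\right)^{1/p}$; for $s=1$, $[\varphi]_{W^{1,p}(\mathbb{R}^N)}=\|\nabla\varphi\|_{L^p(\mathbb{R}^N)}$. $[\varphi]_{C^{0,\alpha}(\mathbb{R}^N)}=\sup_{x\ne y}\frac{|\varphi(x)-\varphi(y)|}{|x-y|^\alpha}$; $\alpha_{s,p}=s-N/p$. $\mathcal{W}^{s,p}(\mathbb{R}^N)$ is the set of continuous functions $\varphi$ with $[\varphi]_{C^{0,\alpha_{s,p}}(\mathbb{R}^N)}<\infty$ and $[\varphi]_{W^{s,p}(\mathbb{R}^N)}<\infty$. *)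

(* Defs.v *)
From HB Require Import structures.
From mathcomp Require Import all_boot all_order all_algebra.
From mathcomp Require Import all_classical all_reals all_analysis.
Set Implicit Arguments. Unset Strict Implicit. Unset Printing Implicit Defensive.
Import Order.TTheory GRing.Theory Num.Theory.
Import numFieldNormedType.Exports.
Local Open Scope classical_set_scope.
Local Open Scope ring_scope.

Section Defs.
Context {R : realType}.

Definition enorm (N : nat) (x : 'rV[R]_N) : R := Num.sqrt (\sum_(i < N) (x 0 i) ^+ 2).

(* Lebesgue integral over R^N of a function with values in \bar R, realised as
   N iterated one-dimensional Lebesgue integrals (Tonelli/Fubini). *)
Fixpoint iint (n : nat) (f : seq R -> \bar R) : \bar R :=
  match n with
  | 0%N => f [::]
  | n'.+1 => (\int[@lebesgue_measure R]_(t in [set: R]) iint n' (fun s => f (t :: s)))%E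
  end.

Definition integral_Rn (N : nat) (f : 'rV[R]_N -> \bar R) : \bar R :=
  iint N (fun s => f (\row_(i < N) nth 0 s i)).

Definition borel_measurable_Rn (N : nat) (g : 'rV[R]_N -> R) : Prop :=
  forall B : set R, measurable B -> <<s [set U : set 'rV[R]_N | open U] >> (g @^-1` B).

Definition unitv (N : nat) (i : 'I_N) : 'rV[R]_N := delta_mx 0 i.
Definition partial (N : nat) (i : 'I_N) (f : 'rV[R]_N -> R) (x : 'rV[R]_N) : R :=
  'D_(unitv i) f x.

Fixpoint iterD (N : nat) (vs : seq 'rV[R]_N) (f : 'rV[R]_N -> R) : 'rV[R]_N -> R :=
  match vs with
  | [::] => f
  | v :: vs' => fun x => 'D_v (iterD vs' f) x
  end.

Definition test_function (N : nat) (psi : 'rV[R]_N -> R) : Prop :=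
  (forall (vs : seq 'rV[R]_N) (x : 'rV[R]_N), differentiable (iterD vs psi) x) /\
  compact (closure [set x | psi x != 0]).

Definition weak_gradient (N : nat) (phi : 'rV[R]_N -> R) (g : 'I_N -> 'rV[R]_N -> R) : Prop :=
  forall (i : 'I_N) (psi : 'rV[R]_N -> R), test_function psi ->
    integral_Rn (fun x => (phi x * partial i psi x)%:E) =
    (- integral_Rn (fun x => (g i x * psi x)%:E))%E.

Definition holder_quot (N : nat) (alpha : R) (phi : 'rV[R]_N -> R) (x y : 'rV[R]_N) : R :=
  `|phi x - phi y| / ((enorm (x - y)) `^ alpha).

Definition holder_seminorm (N : nat) (alpha : R) (phi : 'rV[R]_N -> R) : \bar R :=
  ereal_sup [set z : \bar R | exists x y : 'rV[R]_N, x != y /\ z = (holder_quot alpha phi x y)%:E].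

Definition gagliardo_seminorm (N : nat) (s p : R) (phi : 'rV[R]_N -> R) : \bar R :=
  poweR (integral_Rn (fun x => integral_Rn (fun y =>
     ((`|phi x - phi y| `^ p) / ((enorm (x - y)) `^ (N%:R + s * p)))%:E))) p^-1.

Definition Lp_norm_vec (N : nat) (p : R) (g : 'I_N -> 'rV[R]_N -> R) : \bar R :=
  poweR (integral_Rn (fun x => ((enorm (\row_(i < N) g i x)) `^ p)%:E)) p^-1.

Definition W1p_seminorm_finite (N : nat) (p : R) (phi : 'rV[R]_N -> R) : Prop :=
  exists g : 'I_N -> 'rV[R]_N -> R,
    (forall i, borel_measurable_Rn (g i)) /\ weak_gradient phi g /\
    (Lp_norm_vec p g < +oo)%E.

Definition Wsp_seminorm_finite (N : nat) (s p : R) (phi : 'rV[R]_N -> R) : Prop :=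
  (s < 1 -> (gagliardo_seminorm s p phi < +oo)%E) /\ (s = 1 -> W1p_seminorm_finite p phi).

Definition alpha_sp (N : nat) (s p : R) : R := s - N%:R / p.

Definition calW (N : nat) (s p : R) (phi : 'rV[R]_N -> R) : Prop :=
  continuous phi /\
  (holder_seminorm (alpha_sp N s p) phi < +oo)%E /\
  Wsp_seminorm_finite s p phi.

End Defs.

(* Main.v *)
(** Write r = |x - y|.  A pair whose Hoelder quotient is at least a fixed eps > 0
    captures a fixed amount c > 0 of the finite energy.  For s < 1, phi being
    alpha-Hoelder, |phi(x') - phi(y')| >= (eps/2) r^alpha for x', y' in boxes of
    side comparable to r around x and y, and the Gagliardo integrand over their
    product integrates to a scale-invariant constant.  For s = 1, test the weak
    gradient g against a tube joining u to v, where u, v is one axis-parallel step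
    of a path from x to y; by Young's inequality the energy |g|^p is then captured
    on the part of the box of radius 2r where |g| is at least of order r^(-N/p),
    with weight (r^(N/p) |g|)^(1-p).  In both cases the pieces belonging to pairs
    with very different r, or with far apart x, are essentially disjoint.  Hence
    the pairs with quotient >= eps cannot escape every compact set of {x != y},
    and the supremum is attained by compactness. *)

Require Import Defs.
From HB Require Import structures.
From mathcomp Require Import all_boot all_order all_algebra.
From mathcomp Require Import all_classical all_reals all_analysis.
Set Implicit Arguments.
Unset Strict Implicit.
Unset Printing Implicit Defensive.
Import Order.TTheory GRing.Theory Num.Theory.
From mathcomp Require Import measurable_realfun lra ring.
Import numFieldNormedType.Exports.
Local Open Scope classical_set_scope.
Local Open Scope ring_scope.

(** * Integrals of possibly non-measurable functions *)

(* The integral of a nonnegative function is the supremum of the integrals of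
   the simple functions below it, hence monotone and superadditive without any
   measurability; the inner integrals of [iint] need not be measurable. *)
Section lower_integral.
Context d (T : measurableType d) (R : realType) (mu : {measure set T -> \bar R}).
Implicit Types f g h : T -> \bar R.
Local Open Scope ereal_scope.
Import HBNNSimple.

Lemma ge0_le_integralT f g : (forall x, 0 <= f x) -> (forall x, f x <= g x) ->
  \int[mu]_(x in setT) f x <= \int[mu]_(x in setT) g x.
Proof.
move=> f0 fg; have g0 x : 0 <= g x := le_trans (f0 x) (fg x).
rewrite !ge0_integralTE//; apply: le_ereal_sup => _ [h hf <-].
by exists h => // x; exact: le_trans (hf x) (fg x).
Qed.

Lemma le_integralT f g : (forall x, f x <= g x) ->
  \int[mu]_(x in setT) f x <= \int[mu]_(x in setT) g x.
Proof.
move=> fg; rewrite [leLHS]integralE [leRHS]integralE; apply: leeB.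
  by apply: ge0_le_integralT => // x; rewrite !funeposE ge_max !le_max fg lexx orbT.
apply: ge0_le_integralT => // x; rewrite !funenegE ge_max !le_max lexx !orbT andbT.
by rewrite leeN2 fg.
Qed.

(** The integral is a difference of two nonnegative quantities, each at most the integral of the
    absolute value; if that bound is infinite there is nothing to show. *)
Lemma le_abse_integralT f :
  `|\int[mu]_(x in setT) f x| <= \int[mu]_(x in setT) `|f x|.
Proof.
have le1 : \int[mu]_(x in setT) f^\+ x <= \int[mu]_(x in setT) `|f x|.
  by apply: ge0_le_integralT => // x; rewrite funeposE ge_max abse_ge0 lee_abs.
have le2 : \int[mu]_(x in setT) f^\- x <= \int[mu]_(x in setT) `|f x|.
  apply: ge0_le_integralT => // x.
  by rewrite funenegE ge_max abse_ge0 andbT -abseN lee_abs.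
rewrite integralE.
have := @integral_ge0 _ _ _ mu setT (f^\+) (fun x _ => funepos_ge0 f x).
have := @integral_ge0 _ _ _ mu setT (f^\-) (fun x _ => funeneg_ge0 f x).
move: le1 le2; set a := integral _ _ (f^\+); set b := integral _ _ (f^\-).
case: (integral _ _ _) => [c| |]; last 2 first.
- by move=> *; rewrite leey.
- by move=> + _ _ a0 => /(le_trans a0).
case: a => [a| |] //; case: b => [b| |] //; rewrite !lee_fin => ac bc b0 a0.
by rewrite ler_norml; apply/andP; split; lra.
Qed.

(** Simple functions below [f] and below [g] add up to a simple function below their sum; the rest
    is arithmetic of suprema. *)
Lemma ge0_integral_superadd f g : (forall x, 0 <= f x) -> (forall x, 0 <= g x) ->
  \int[mu]_(x in setT) f x + \int[mu]_(x in setT) g x <=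
  \int[mu]_(x in setT) (f x + g x).
Proof.
move=> f0 g0; have fg0 x : 0 <= f x + g x by rewrite adde_ge0.
rewrite [X in X + _]ge0_integralTE// [X in _ + X]ge0_integralTE//.
rewrite [leRHS]ge0_integralTE//.
set A := [set _ | _ in _]; set B := [set _ | _ in _]; set C := [set _ | _ in _].
have A0 z : A z -> 0 <= z by move=> [h _ <-]; exact: sintegral_ge0.
have B0 z : B z -> 0 <= z by move=> [h _ <-]; exact: sintegral_ge0.
have AB a b : A a -> B b -> a + b <= ereal_sup C.
  move=> [h hf <-] [k kg <-]; apply: ereal_sup_ubound.
  exists (add_nnsfun h k); last by rewrite sintegralD.
  by move=> x /=; rewrite EFinD; exact: leeD.
(* Once the right-hand supremum is finite, all quantities are finite and subtraction is
   legitimate. *)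
have [Cy|Cfin] := eqVneq (ereal_sup C) +oo; first by rewrite Cy leey.
have nn0 : A 0 by exists nnsfun0 => //; exact: sintegral0.
have nn0' : B 0 by exists nnsfun0 => //; exact: sintegral0.
have C0 : 0 <= ereal_sup C by have := AB _ _ nn0 nn0'; rewrite adde0.
have Cf : ereal_sup C \is a fin_num by rewrite ge0_fin_numE// ltey.
have Afin a : A a -> a \is a fin_num.
  move=> Aa; rewrite ge0_fin_numE ?A0// (@le_lt_trans _ _ (ereal_sup C)) ?ltey//.
  by have := AB _ _ Aa nn0'; rewrite adde0.
have step a : A a -> ereal_sup B <= ereal_sup C - a.
  move=> Aa; apply: ge_ereal_sup => b Bb.
  by rewrite leeBrDl ?Afin// AB.
have Bfin : ereal_sup B \is a fin_num.
  rewrite ge0_fin_numE; last exact: ereal_sup_ubound.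
  by have := step _ nn0; rewrite sube0 => /le_lt_trans; apply; rewrite ltey.
rewrite -leeBrDr//; apply: ge_ereal_sup => a Aa.
by rewrite leeBrDr// -leeBrDl ?Afin// step.
Qed.

(** Lower integrals are not subadditive in general, but one measurable summand suffices: for a
    simple [h] below the sum, the positive part of [h - f] is measurable and lies below [g]. *)
Lemma ge0_integral_subadd (f : T -> R) g :
  measurable_fun setT f -> (forall x, (0 <= f x)%R) -> (forall x, 0 <= g x) ->
  \int[mu]_(x in setT) ((f x)%:E + g x) <=
  \int[mu]_(x in setT) (f x)%:E + \int[mu]_(x in setT) g x.
Proof.
move=> mf f0 g0; rewrite [leLHS]ge0_integralTE; last first.
  by move=> x; rewrite adde_ge0 ?lee_fin.
apply: ge_ereal_sup => _ [h hfg <-].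
have mh : measurable_fun setT h by [].
pose k := ((h \- f)^\+)%R.
have mk : measurable_fun setT k by apply: measurable_funrpos; exact: measurable_funB.
have k0 x : (0 <= k x)%R by rewrite /k /funrpos le_max lexx orbT.
have -> : sintegral mu h = \int[mu]_(x in setT) (h x)%:E.
  by rewrite integral_nnsfun//; congr sintegral; rewrite patch_setT.
apply: (@le_trans _ _ (\int[mu]_(x in setT) ((f x)%:E + (k x)%:E))).
  apply: ge0_le_integralT => x; first by rewrite lee_fin.
  by rewrite -EFinD lee_fin -lerBlDl /k /funrpos le_max lexx.
rewrite ge0_integralD//; last 4 first.
- by move=> x _; rewrite lee_fin.
- exact/measurable_EFinP.
- by move=> x _; rewrite lee_fin.
- exact/measurable_EFinP.
apply: leeD => //; apply: ge0_le_integralT => x; first by rewrite lee_fin.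
rewrite /k /funrpos EFin_max ge_max g0 andbT EFinB leeBlDl//; exact: hfg.
Qed.

End lower_integral.

(** * Iterated integrals, by induction on the number of variables *)

Section iterated_integral.
Context {R : realType}.
Implicit Types f g : seq R -> \bar R.
Local Notation mu := (@lebesgue_measure R).

Lemma iint_ge0 n f : (forall s, 0 <= f s)%E -> (0 <= iint n f)%E.
Proof.
by elim: n f => [|n IH] f f0 //=; apply: integral_ge0 => t _; exact: IH.
Qed.

Lemma le_iint n f g : (forall s, f s <= g s)%E -> (iint n f <= iint n g)%E.
Proof.
by elim: n f g => [|n IH] f g fg //=; apply: le_integralT => t; exact: IH.
Qed.

Lemma le_abse_iint n f : (`|iint n f| <= iint n (fun s => `|f s|))%E.
Proof.
elim: n f => [|n IH] f //=; apply: le_trans (le_abse_integralT _ _) _.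
by apply: le_integralT => t; exact: IH.
Qed.

Lemma iint_superadd n f g : (forall s, 0 <= f s)%E -> (forall s, 0 <= g s)%E ->
  (iint n f + iint n g <= iint n (fun s => f s + g s))%E.
Proof.
elim: n f g => [|n IH] f g f0 g0 //=.
apply: le_trans (ge0_integral_superadd _ _ _) _ => [t|t|].
- exact: iint_ge0.
- exact: iint_ge0.
- by apply: le_integralT => t; exact: IH.
Qed.

(** With a product as first summand, its inner integrals are explicit multiples of one factor, hence
    measurable, so the one-dimensional subadditivity applies at every level. The constant [c]
    absorbs the factors of the variables already fixed. *)
Lemma iint_subadd_prod n (u : 'I_n -> R -> R) (a : 'I_n -> R) (c : R) g :
  0 <= c -> (forall i, measurable_fun setT (u i)) ->
  (forall i t, 0 <= u i t) ->
  (forall i, \int[mu]_(t in setT) (u i t)%:E = (a i)%:E)%E ->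
  (forall s, 0 <= g s)%E ->
  (iint n (fun s => (c * \prod_(i < n) u i (nth 0 s i))%:E + g s) <=
   (c * \prod_(i < n) a i)%:E + iint n g)%E.
Proof.
elim: n u a c g => [|n IH] u a c g c0 mu_ u0 ua g0 /=.
  by rewrite !big_ord0.
have a0 i : 0 <= a i.
  by rewrite -lee_fin -ua; apply: integral_ge0 => t _; rewrite lee_fin.
pose A := c * \prod_(i < n) a (lift ord0 i).
have A0 : 0 <= A by rewrite mulr_ge0// prodr_ge0.
apply: (@le_trans _ _ (\int[mu]_(t in setT)
    ((A * u ord0 t)%:E + iint n (fun s => g (t :: s))))%E).
  apply: le_integralT => t.
  apply: le_trans; last first.
    have := IH (fun i => u (lift ord0 i)) (fun i => a (lift ord0 i))
      (c * u ord0 t) (fun s => g (t :: s)) (mulr_ge0 c0 (u0 _ _))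
      (fun i => mu_ _) (fun i => u0 _) (fun i => ua _) (fun s => g0 _).
    by rewrite mulrAC; apply.
  apply: le_iint => s; rewrite big_ord_recl /= mulrA.
  by rewrite lexx.
apply: le_trans.
  apply: ge0_integral_subadd => [|t|t].
  - by apply: measurable_funM => //; exact: mu_.
  - by rewrite mulr_ge0.
  - exact: iint_ge0.
apply: leeD => //; under eq_integral do rewrite EFinM.
rewrite ge0_integralZl_EFin//; last 2 first.
- by move=> t _; rewrite lee_fin.
- by apply/measurable_EFinP; exact: mu_.
by rewrite ua -EFinM lee_fin big_ord_recl /A mulrA mulrAC mulrC mulrA.
Qed.

(** Two products are integrated at once, so that linearity is only used for integrable functions of
    one variable; [k] and [l], of any sign, absorb the factors already fixed. *)
Lemma iint_prodB n (u w : 'I_n -> R -> R) (a b : 'I_n -> R) (k l : R) :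
  (forall i, mu.-integrable setT (EFin \o u i)) ->
  (forall i, mu.-integrable setT (EFin \o w i)) ->
  (forall i, \int[mu]_(t in setT) (u i t)%:E = (a i)%:E)%E ->
  (forall i, \int[mu]_(t in setT) (w i t)%:E = (b i)%:E)%E ->
  iint n (fun s => (k * \prod_(i < n) u i (nth 0 s i) -
                    l * \prod_(i < n) w i (nth 0 s i))%:E) =
  (k * \prod_(i < n) a i - l * \prod_(i < n) b i)%:E.
Proof.
elim: n u w a b k l => [|n IH] u w a b k l iu iw ua wb /=.
  by rewrite !big_ord0.
pose A := k * \prod_(i < n) a (lift ord0 i).
pose B := l * \prod_(i < n) b (lift ord0 i).
transitivity (\int[mu]_(t in setT) ((A%:E * (u ord0 t)%:E) - (B%:E * (w ord0 t)%:E)))%E.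
  apply: eq_integral => t _.
  rewrite -!EFinM -EFinB.
  rewrite [in RHS]/A [in RHS]/B [in RHS]mulrAC [X in (_ - X)%:E]mulrAC.
  rewrite -(IH (fun i => u (lift ord0 i)) (fun i => w (lift ord0 i))) //.
  by congr iint; apply/funext => s; rewrite !big_ord_recl /= !mulrA.
rewrite integralB//; last 2 first.
- by apply: integrableZl => //; exact: iu.
- by apply: integrableZl => //; exact: iw.
rewrite !integralZl//; last 2 first.
- exact: iw.
- exact: iu.
rewrite ua wb -!EFinM -EFinB !big_ord_recl /A /B; congr (_%:E); ring.
Qed.

End iterated_integral.

(** * The same facts for integrals over R^N *)

Section integral_Rn.
Context {R : realType} {N : nat}.
Implicit Types f g : 'rV[R]_N -> \bar R.
Local Notation mu := (@lebesgue_measure R).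

Lemma integral_Rn_ge0 f : (forall x, 0 <= f x)%E -> (0 <= integral_Rn f)%E.
Proof. by move=> f0; exact: iint_ge0. Qed.

Lemma le_integral_Rn f g : (forall x, f x <= g x)%E ->
  (integral_Rn f <= integral_Rn g)%E.
Proof. by move=> fg; exact: le_iint. Qed.

Lemma le_abse_integral_Rn f :
  (`|integral_Rn f| <= integral_Rn (fun x => `|f x|))%E.
Proof. exact: le_abse_iint. Qed.

Lemma integral_Rn_superadd f g :
  (forall x, 0 <= f x)%E -> (forall x, 0 <= g x)%E ->
  (integral_Rn f + integral_Rn g <= integral_Rn (fun x => f x + g x))%E.
Proof. by move=> f0 g0; exact: iint_superadd. Qed.

Lemma integral_Rn_subadd_prod (u : 'I_N -> R -> R) (a : 'I_N -> R) (c : R) g :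
  0 <= c -> (forall i, measurable_fun setT (u i)) ->
  (forall i t, 0 <= u i t) ->
  (forall i, \int[mu]_(t in setT) (u i t)%:E = (a i)%:E)%E ->
  (forall x, 0 <= g x)%E ->
  (integral_Rn (fun x => (c * \prod_(i < N) u i (x 0 i))%:E + g x) <=
   (c * \prod_(i < N) a i)%:E + integral_Rn g)%E.
Proof.
move=> c0 mu_ u0 ua g0; apply: le_trans (iint_subadd_prod _ mu_ u0 ua _) => //.
by apply: le_iint => s; under eq_bigr do rewrite mxE.
Qed.

Lemma integral_Rn_prodB (u w : 'I_N -> R -> R) (a b : 'I_N -> R) (k l : R) :
  (forall i, mu.-integrable setT (EFin \o u i)) ->
  (forall i, mu.-integrable setT (EFin \o w i)) ->
  (forall i, \int[mu]_(t in setT) (u i t)%:E = (a i)%:E)%E ->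
  (forall i, \int[mu]_(t in setT) (w i t)%:E = (b i)%:E)%E ->
  integral_Rn (fun x => (k * \prod_(i < N) u i (x 0 i) -
                         l * \prod_(i < N) w i (x 0 i))%:E) =
  (k * \prod_(i < N) a i - l * \prod_(i < N) b i)%:E.
Proof.
move=> iu iw ua wb; rewrite -(iint_prodB k l iu iw ua wb).
congr iint; apply/funext => s.
by congr ((_ * _ - _ * _)%:E); apply: eq_bigr => i _; rewrite mxE.
Qed.

Lemma integral_Rn_prod (u : 'I_N -> R -> R) (a : 'I_N -> R) (k : R) :
  (forall i, mu.-integrable setT (EFin \o u i)) ->
  (forall i, \int[mu]_(t in setT) (u i t)%:E = (a i)%:E)%E ->
  integral_Rn (fun x => (k * \prod_(i < N) u i (x 0 i))%:E) =
  (k * \prod_(i < N) a i)%:E.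
Proof.
move=> iu ua; have := integral_Rn_prodB k 0 iu iu ua ua.
rewrite mul0r subr0 => <-; congr integral_Rn; apply/funext => x.
by rewrite mul0r subr0.
Qed.

End integral_Rn.

(** * Packing of separated pairs *)

Section packing.
Context {R : realType} {V : normedModType R}.
Implicit Types (q : V * V) (L : R).

(** On row vectors this is the sup-norm distance, comparable to [enorm] and better suited to
    boxes. *)
Definition gap q : R := `|q.1 - q.2|.

Definition separated L q q' : Prop :=
  [\/ L * gap q <= gap q', L * gap q' <= gap q |
      L * (gap q + gap q') <= `|q.1 - q'.1|].

(** In finite dimension the excluded regions are the compact ones off the diagonal. *)
Definition escapes (S : set (V * V)) : Prop := forall a b M : R, 0 < a ->
  exists2 q, S q & ~ (a <= gap q <= b /\ `|q.1| <= M).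

(** The list is built greedily: finitely many pairs give bounds [a] and [b], and escaping provides a
    new pair separated from all of them. *)
Lemma escapes_separated (S : set (V * V)) L : 0 < L ->
  (forall q, S q -> 0 < gap q) -> escapes S ->
  forall n, exists l : seq (V * V),
    [/\ size l = n, forall q, q \in l -> S q &
        pairwise (fun q q' => `[< separated L q q' >]) l].
Proof.
move=> L0 gap0 escS; elim=> [|n [l [sl Sl pl]]]; first by exists [::].
have [a a0 Ha] : exists2 a, 0 < a & forall q, q \in l -> L * a <= gap q.
  elim: l {sl pl} Sl => [|q l IH] Sl; first by exists 1.
  have [|a a0 Ha] := IH; first by move=> q' q'l; apply: Sl; rewrite inE q'l orbT.
  have gq : 0 < gap q by apply/gap0/Sl; rewrite mem_head.
  exists (Num.min a (gap q / L)); first by rewrite lt_min a0 divr_gt0.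
  move=> q'; rewrite inE => /predU1P[->|q'l].
    by rewrite mulrC -ler_pdivlMr// ge_min lexx orbT.
  by apply: le_trans (Ha _ q'l); rewrite ler_pM2l// ge_min lexx.
have [b Hb] : exists b, forall q, q \in l -> L * gap q <= b /\ L * gap q + `|q.1| <= b.
  elim: l {sl pl Ha} Sl => [|q l IH] Sl; first by exists 0.
  have [|b Hb] := IH; first by move=> q' q'l; apply: Sl; rewrite inE q'l orbT.
  exists (Num.max b (L * gap q + `|q.1|)) => q'; rewrite inE => /predU1P[->|q'l].
    by rewrite !le_max lexx !orbT lerDl normr_ge0 orbT.
  by have [h1 h2] := Hb _ q'l; rewrite !le_max h1 h2.
(* A gap below [a] gives the first alternative and a gap above [b] the second; otherwise [q.1] has
   norm above [L * b + b], which forces the third. *)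
have [q Sq Hq] := escS a b (L * b + b) a0.
exists (q :: l); split; first by rewrite /= sl.
  by move=> q'; rewrite inE => /predU1P[->|/Sl].
rewrite /= pl andbT; apply/allP => q' q'l; apply/asboolP.
have [h1 h2] := Hb _ q'l; have h3 := Ha _ q'l.
have [qa|qa] := ltP (gap q) a.
  by apply: Or31; apply: le_trans h3; rewrite ler_pM2l// ltW.
have [qb|qb] := ltP b (gap q); first by apply: Or32; exact: le_trans h1 (ltW qb).
apply: Or33; have qM : L * b + b < `|q.1|.
  by rewrite ltNge; apply/negP => qM; apply: Hq; rewrite qa qb qM.
have : L * gap q <= L * b by rewrite ler_pM2l.
have := lerB_dist q.1 q'.1; rewrite mulrDr; lra.
Qed.

(** At most one entry of the list can exceed [eta], and that one is at most [C]. *)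
Lemma sum_le_of_pairwise_min (T : Type) (v : T -> R) (eta C : R) (l : seq T) :
  0 <= eta -> 0 <= C -> (forall x, v x <= C) ->
  pairwise (fun x y => Num.min (v x) (v y) <= eta) l ->
  \sum_(x <- l) v x <= C + (size l)%:R * eta.
Proof.
move=> eta0 C0 vC; elim: l => [|x l IH] /=; first by rewrite big_nil mul0r addr0.
move=> /andP[xl /IH{IH}IH]; rewrite big_cons -addn1 natrD mulrDl mul1r.
have [vx|vx] := leP (v x) eta; first by rewrite addrA addrC lerD.
have : \sum_(y <- l) v y <= (size l)%:R * eta.
  elim: l xl {IH} => [|y l IH] /=; first by rewrite big_nil mul0r.
  move=> /andP[xy /IH{}IH]; rewrite big_cons -add1n natrD mulrDl mul1r lerD//.
  by move: xy; rewrite ge_min leNgt vx.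
by have := vC x; lra.
Qed.

(* If infinitely many pairwise well separated pairs each captured a fixed
   amount of energy through weights summing to at most 1, the energy would be
   infinite. *)
Lemma bounded_of_energy (P : Type) (I : (P -> \bar R) -> \bar R) (F : P -> R)
    (S : set (V * V)) (W : V * V -> P -> R) (c : R) :
  (forall f, (forall z, 0 <= f z)%E -> (0 <= I f)%E) ->
  (forall f g, (forall z, f z <= g z)%E -> (I f <= I g)%E) ->
  (forall f g, (forall z, 0 <= f z)%E -> (forall z, 0 <= g z)%E ->
    (I f + I g <= I (fun z => f z + g z))%E) ->
  (forall z, 0 <= F z) -> (I (EFin \o F) < +oo)%E ->
  (forall q, S q -> 0 < gap q) ->
  (forall q z, 0 <= W q z <= 2^-1) ->
  0 < c -> (forall q, S q -> (c%:E <= I (fun z => (F z * W q z)%:E))%E) ->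
  (forall eta, 0 < eta -> exists2 L, 0 < L & forall q q', S q -> S q' ->
    separated L q q' -> forall z, Num.min (W q z) (W q' z) <= eta) ->
  exists a b M, 0 < a /\ forall q, S q -> a <= gap q <= b /\ `|q.1| <= M.
Proof.
move=> I0 Imono Iadd F0 IF gap0 W01 c0 HW Hsep.
suff : ~ escapes S.
  move=> nesc; apply: contrapT => H; apply: nesc => a b M a0.
  apply: contrapT => H2; apply: H; exists a, b, M; split => // q Sq.
  by apply: contrapT => H3; apply: H2; exists q.
move=> escS.
have IFfin : I (EFin \o F) \is a fin_num.
  by rewrite ge0_fin_numE// I0// => z; rewrite lee_fin.
(* So many pairs that [n * c] exceeds the whole energy. *)
pose n := (Num.truncn (fine (I (EFin \o F)) / c)).+1.
have nc : fine (I (EFin \o F)) < n%:R * c.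
  by rewrite -ltr_pdivrMr// /n truncnS_gt.
have n0 : 0 < (2 * n%:R)^-1 :> R by rewrite invr_gt0 mulr_gt0// ltr0n.
(* With overlaps at most [1 / (2 n)], the weights of [n] pairs sum to at most 1/2 + 1/2. *)
have [L L0 HL] := Hsep _ n0.
have [l [sl Sl pl]] := escapes_separated L0 gap0 escS n.
have HlS (l' : seq (V * V)) : {subset l' <= l} ->
    (((size l')%:R * c)%:E <= I (fun z => (F z * \sum_(q <- l') W q z)%:E))%E.
  elim: l' => [|q l' IH] l'l.
    by rewrite mul0r I0// => z; rewrite big_nil mulr0.
  have ql : S q by apply/Sl/l'l; rewrite mem_head.
  have {}IH := IH (fun q' h => l'l q' (@mem_behead _ (q :: l') q' h)).
  rewrite [size _]/= -add1n natrD mulrDl mul1r EFinD.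
  apply: le_trans (leeD (HW _ ql) IH) _.
  apply: le_trans (Iadd _ _ _ _) _ => [z|z|].
  - by rewrite lee_fin mulr_ge0//; case/andP: (W01 q z).
  - by rewrite lee_fin mulr_ge0// sumr_ge0// => q' _; case/andP: (W01 q' z).
  - by apply: Imono => z; rewrite -EFinD lee_fin big_cons mulrDr.
have := HlS l (fun _ => id).
have sumW z : \sum_(q <- l) W q z <= 1.
  apply: le_trans (@sum_le_of_pairwise_min _ (W^~ z) _ 2^-1 l (ltW n0) _ _ _) _.
  - by rewrite invr_ge0.
  - by move=> q; case/andP: (W01 q z).
  - elim: l pl Sl {sl HlS} => [//|q l IH] /= /andP[ql pl] Sl.
    rewrite IH// => [|q' q'l]; last by apply: Sl; rewrite inE q'l orbT.
    rewrite andbT; apply/allP => q' q'l; apply: HL.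
    + by apply: Sl; rewrite mem_head.
    + by apply: Sl; rewrite inE q'l orbT.
    + by have /asboolP := allP ql _ q'l.
  - by rewrite sl invfM mulrCA divff ?pnatr_eq0// mulr1; lra.
move=> /le_trans/(_ (Imono _ (EFin \o F) _)).
rewrite sl -(fineK IFfin) lee_fin leNgt nc => /(_ _)/notF; apply => z.
by rewrite lee_fin ler_piMr.
Qed.

End packing.

(** * Boxes *)

Section boxes.
Context {R : realType} {N : nat}.
Implicit Types (w x z : 'rV[R]_N).
Local Notation mu := (@lebesgue_measure R).

Lemma le_coord_rV_norm x j : `|x 0 j| <= `|x|.
Proof.
by rewrite [leRHS]/Num.Def.normr/= mx_normrE; apply/bigmax_geP; right; exists (0, j).
Qed.

Lemma rV_norm_le x c : 0 <= c -> (forall j, `|x 0 j| <= c) -> `|x| <= c.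
Proof.
move=> c0 H; rewrite [leLHS]/Num.Def.normr/= mx_normrE (bigmax_le _ c0)//= => -[i j] _.
by rewrite (ord1 i) H.
Qed.

Lemma rV_norm_le_enorm x : `|x| <= enorm x.
Proof.
apply: rV_norm_le; first exact: sqrtr_ge0.
move=> j; rewrite -sqrtr_sqr ler_wsqrtr// (bigD1 j)//= lerDl sumr_ge0//.
by move=> i _; exact: sqr_ge0.
Qed.

Lemma enorm_le_rV_norm x : enorm x <= Num.sqrt N%:R * `|x|.
Proof.
rewrite -[leRHS]/(_ * `|x|) -[in leRHS](normr_id x) -sqrtr_sqr -sqrtrM// ler_wsqrtr//.
rewrite -[N in N%:R]card_ord mulr_natl -sumr_const ler_sum// => j _.
by rewrite -(real_normK (num_real (x 0 j))) lerXn2r ?nnegrE// le_coord_rV_norm.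
Qed.

(** The indicator of a closed sup-norm ball, written as a product so that iterated integrals
    factor. *)
Definition box (w : 'rV[R]_N) (h : R) (z : 'rV[R]_N) : R :=
  \prod_(j < N) \1_(`[w 0 j - h, w 0 j + h]) (z 0 j).

Lemma boxE w h z : 0 <= h -> box w h z = (`|z - w| <= h)%R%:R.
Proof.
move=> h0; have cE j : (z 0 j \in `[w 0 j - h, w 0 j + h]%classic) =
    (`|(z - w) 0 j| <= h).
  rewrite mem_setE in_itv/= !mxE ler_norml.
  by apply/idP/idP => /andP[? ?]; apply/andP; split; lra.
have [zw|zw] := boolP (`|z - w| <= h).
  rewrite /box big1// => j _; rewrite indicE cE.
  by rewrite (le_trans (le_coord_rV_norm _ _) zw).
have [j hj] : exists j, ~~ (`|(z - w) 0 j| <= h).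
  apply/existsP; rewrite -negb_forall; apply: contra zw => /forallP.
  exact: rV_norm_le.
by rewrite /box (bigD1 j)//= indicE cE (negbTE hj) mul0r.
Qed.

Lemma integral_indic_centered (c h : R) : 0 <= h ->
  (\int[mu]_(t in setT) (\1_(`[c - h, c + h]) t)%:E = (2 * h)%:E)%E.
Proof.
move=> h0; rewrite integral_indic//= setIT/= lebesgue_measure_itv /= lte_fin.
case: ltP => hc; first by rewrite -EFinB; congr (_%:E); ring.
by congr (_%:E); lra.
Qed.

End boxes.

(** * Smooth bumps *)

Section flat.
Context {R : realType}.

(** For [n = 0] this is the classical smooth function exp(-1/t) extended by zero; the powers of 1/t
    make the family stable under differentiation, up to linear combinations. *)
Definition flat (n : nat) (t : R) : R :=
  if 0 < t then t^-1 ^+ n * expR (- t^-1) else 0.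

Lemma flat_ge0 n t : 0 <= flat n t.
Proof.
rewrite /flat; case: ifPn => // t0.
by rewrite mulr_ge0 ?expR_ge0// exprn_ge0// invr_ge0 ltW.
Qed.

Lemma flat_le0 n t : t <= 0 -> flat n t = 0.
Proof. by rewrite /flat leNgt => /negbTE ->. Qed.

Lemma flatS n t : flat n.+1 t = t^-1 * flat n t.
Proof. by rewrite /flat; case: ifPn => _; rewrite ?mulr0// exprS mulrA. Qed.

(** With u = 1/t this is u^n / n! <= exp(u), from the power series. *)
Lemma flat_bounded n t : flat n t <= n`!%:R.
Proof.
rewrite /flat; case: ifPn => [t0|_]; last by rewrite ler0n.
rewrite expRN ler_pdivrMr ?expR_gt0//.
have u0 : 0 <= t^-1 by rewrite invr_ge0 ltW.
case: n => [|n].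
  by rewrite expr0 fact0 mul1r; have := expR_ge1Dx t^-1; lra.
rewrite mulrC -ler_pdivrMr ?ltr0n ?fact_gt0//.
by have := expR_ge1Dxn n u0; lra.
Qed.

Lemma is_derive_flat n (t : R) :
  is_derive t 1 (flat n) (flat n.+2 t - n%:R * flat n.+1 t).
Proof.
have [t0|t0|->] := ltgtP t 0.
- rewrite !flat_le0 ?ltW// mulr0 subr0.
  apply: (@near_eq_is_derive _ _ _ (cst 0)).
  near=> u; rewrite flat_le0//; apply/ltW; near: u; exact: lt_nbhsl.
- have dV : is_derive t 1 (fun u : R => u^-1) (- t ^- 2).
    have t_neq0 : t != 0 by rewrite gt_eqF.
    apply: DeriveDef; first exact: derivableV.
    by rewrite deriveV// derive_id -[_ *: _]/(_ * _) mulr1.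
  have dX := is_deriveX n dV.
  have dE := is_derive1_comp (is_derive_expR _) (is_deriveN dV).
  have near_flat : \near t,
      (((fun u : R => u^-1) ^+ n * (expR \o (- (fun u : R => u^-1)))) : R -> R) t = flat n t.
    near=> u; rewrite /flat ifT; last by near: u; exact: lt_nbhsr.
    by rewrite !fctE.
  apply: is_derive_eq (near_eq_is_derive near_flat (is_deriveM dX dE)) _.
  rewrite /flat t0 -![_ *: _]/(_ * _) /= !fctE.
  case: n {dX near_flat} => [|n] /=; first by rewrite !expr0 exprVn; ring.
  rewrite -!exprVn !exprS expr0; move: (t^-1) (t^-1 ^+ n) (n.+1%:R) => v w m; ring.
- rewrite !(@flat_le0 _ 0)// mulr0 subr0.
  (* At the origin the difference quotient equals [h * flat n.+2 h], which is at most |h| (n+2)! in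
     absolute value. *)
  have cv : h^-1 *: (flat n (h *: 1 + 0) - flat n 0) @[h --> 0^'] --> (0 : R).
    apply/cvgrPdist_le => /= e e0.
    have C0 : 0 < n.+2`!%:R :> R by rewrite ltr0n fact_gt0.
    near=> h; rewrite sub0r normrN (@flat_le0 _ 0)// subr0 addr0.
    have -> : h *: (1 : R) = h by rewrite -[_ *: _]/(_ * _) mulr1.
    have h0 : h != 0 by near: h; exact: nbhs_dnbhs_neq.
    have -> : h^-1 *: flat n h = h * flat n.+2 h.
      by rewrite !flatS mulVKf.
    rewrite normrM (ger0_norm (flat_ge0 _ _)).
    apply: (@le_trans _ _ (`|h| * n.+2`!%:R)).
      by rewrite ler_wpM2l// flat_bounded.
    rewrite -ler_pdivlMr//; near: h; apply: dnbhs0_le; exact: divr_gt0.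
  apply: DeriveDef; first by apply/cvg_ex; exists 0.
  by rewrite /derive; apply/cvg_lim.
Unshelve. all: by end_near. Qed.

Lemma continuous_flat n : continuous (flat n).
Proof.
move=> t; apply: differentiable_continuous; apply/derivable1_diffP.
by have [] := is_derive_flat n t.
Qed.

Local Notation mu := (@lebesgue_measure R).

(** A smooth bump vanishing outside the open unit interval. *)
Definition hat (t : R) : R := flat 0 t * flat 0 (1 - t).

Lemma hat_ge0 t : 0 <= hat t.
Proof. by rewrite mulr_ge0 ?flat_ge0. Qed.

Lemma hat_le1 t : hat t <= 1.
Proof.
have F (u : R) : flat 0 u <= 1 by have := flat_bounded 0 u; rewrite fact0.
by rewrite /hat -[leRHS]mulr1 ler_pM ?flat_ge0.
Qed.

Lemma hat_eq0 t : (t <= 0) || (1 <= t) -> hat t = 0.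
Proof.
by rewrite /hat => /orP[t0|t1]; [rewrite flat_le0 ?mul0r|
  rewrite (@flat_le0 _ (1 - t)) ?mulr0//; lra].
Qed.

Lemma continuous_hat : continuous hat.
Proof.
move=> t; rewrite /hat; apply: cvgM; first exact: continuous_flat.
apply: (@continuous_comp _ _ _ (fun t : R => 1 - t) (flat 0)); last exact: continuous_flat.
by apply: cvgB; [exact: cvg_cst|exact: cvg_id].
Qed.

Lemma integrable_hat : mu.-integrable setT (EFin \o hat).
Proof.
have : mu.-integrable `[0, 1] (EFin \o hat).
  apply: continuous_compact_integrable; first exact: segment_compact.
  by apply: continuous_subspaceT => ?; exact: continuous_hat.
move=> h; have := (@integrable_mkcond _ _ _ mu _ (EFin \o hat) (measurable_itv `[0, 1])).1 h.
congr (mu.-integrable _ _); apply/funext => t; rewrite /patch.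
case: ifPn => // /negP t01; rewrite /= hat_eq0//.
apply/negP => H; apply: t01; rewrite inE /= in_itv /=.
by move: H; case: leP => // /ltW -> /=; case: leP => // /ltW ->.
Qed.

(** A smooth transition from 0 to [step 1], the total mass of [hat]. It is not normalised, so
    [step 1] enters later constants. *)
Definition step (t : R) : R := (\int[mu]_(u in `]-oo, t]) hat u)%R.

Lemma is_derive_step (t : R) : is_derive t 1 step (hat t).
Proof.
have [||||] := @continuous_FTC1 _ hat -oo%O t (t + 1).
- by rewrite ltrDl.
- by apply: integrableS integrable_hat.
- exact: ltNyr.
- exact: continuous_hat.
by move=> dF <-; apply: DeriveDef => //; rewrite derive1E.
Qed.

Lemma step_le0 t : t <= 0 -> step t = 0.
Proof.
move=> t0; rewrite /step /Rintegral integral0_eq//= => u.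
by rewrite in_itv /= => ut; rewrite hat_eq0// (le_trans ut t0).
Qed.

Lemma step_integral t : 1 <= t -> (\int[mu]_(u in setT) (hat u)%:E)%E = (step t)%:E.
Proof.
move=> t1; rewrite /step /Rintegral fineK; last first.
  by apply: integrable_fin_num => //; exact: integrableS integrable_hat.
rewrite [RHS]integral_mkcond; apply: eq_integral => u _; rewrite /patch.
case: ifPn => // /negP h; rewrite hat_eq0//.
apply/orP; right; case: (leP 1 u) => // u1; exfalso; apply: h.
by rewrite inE /= in_itv /= (le_trans (ltW u1)).
Qed.

Lemma step_ge1 t : 1 <= t -> step t = step 1.
Proof. by move=> t1; apply: EFin_inj; rewrite -!step_integral. Qed.

Lemma step_ge0 t : 0 <= step t.
Proof.
by apply: fine_ge0; apply: integral_ge0 => u _; rewrite lee_fin hat_ge0.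
Qed.

Lemma step_le_step1 t : step t <= step 1.
Proof.
have [t1|t1] := leP 1 t; first by rewrite (step_ge1 t1).
rewrite -lee_fin -(step_integral (lexx 1)) /step /Rintegral fineK; last first.
  by apply: integrable_fin_num => //; exact: integrableS integrable_hat.
rewrite integral_mkcond; apply: le_integralT => u; rewrite /patch.
by case: ifPn => // _; rewrite lee_fin hat_ge0.
Qed.

Lemma step1_gt0 : 0 < step 1.
Proof.
(* On the middle half of the unit interval both factors of [hat] are at least exp(-4). *)
have b14 t : 4^-1 <= t <= 3 / 4 -> expR (- 4) ^+ 2 <= hat t.
  move=> /andP[h1 h2].
  have F (u : R) : 4^-1 <= u -> expR (- 4) <= flat 0 u.
    move=> hu; have u0 : 0 < u by lra.
    rewrite /flat u0 expr0 mul1r ler_expR lerN2.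
    by rewrite -[leRHS]invrK lef_pV2// posrE invr_gt0.
  by rewrite expr2 ler_pM ?expR_ge0// F//; lra.
rewrite -lte_fin -(step_integral (lexx 1)).
have : (\int[mu]_(t in setT) (expR (- 4) ^+ 2 * \1_(`[4^-1, 3 / 4]) t)%:E <=
        \int[mu]_(t in setT) (hat t)%:E)%E.
  apply: le_integralT => t; rewrite lee_fin indicE.
  case: (boolP (t \in _)) => [|_]; last by rewrite mulr0 hat_ge0.
  by rewrite inE /= in_itv /= mulr1 => /b14.
apply: lt_le_trans; under eq_integral do rewrite EFinM.
rewrite integralZl//; last first.
  exact: integrable_indic_itv.
rewrite integral_indic//= setIT/= lebesgue_measure_itv /= lte_fin.
rewrite ifT; last by lra.
by rewrite -EFinB -EFinM lte_fin mulr_gt0// ?exprn_gt0 ?expR_gt0//; lra.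
Qed.

(** A rescaled [step] is an antiderivative, evaluated at the ends of an interval that contains the
    support with a margin on both sides. *)
Lemma integral_hat_scaled (rho u : R) : 0 < rho ->
  mu.-integrable setT (EFin \o (fun t => hat (rho^-1 * t - rho^-1 * u))) /\
  (\int[mu]_(t in setT) (hat (rho^-1 * t - rho^-1 * u))%:E =
   (rho * step 1)%:E)%E.
Proof.
move=> rho0; set f := fun t => hat _.
have rV0 : 0 < rho^-1 by rewrite invr_gt0.
have cf : continuous f.
  move=> t; apply: (@continuous_comp _ _ _ (fun t => rho^-1 * t - rho^-1 * u) hat);
    last exact: continuous_hat.
  apply: cvgB; last exact: cvg_cst.
  by apply: cvgM; [exact: cvg_cst|exact: cvg_id].
have f0 t : t \notin `[u - rho, u + 2 * rho] -> f t = 0.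
  move=> h; apply: hat_eq0; rewrite -mulrBr.
  move: h; rewrite in_itv/= negb_and -!ltNge => /orP[h|h]; apply/orP; [left|right].
    by rewrite mulr_ge0_le0// ?ltW//; lra.
  by rewrite mulrC ler_pdivlMr// mul1r; lra.
have E : (EFin \o f) \_ `[u - rho, u + 2 * rho] = EFin \o f.
  apply/funext => t; rewrite /patch; case: ifPn => // h /=.
  by rewrite f0//; apply: contra h; rewrite inE.
split.
  rewrite -E.
  apply: (@integrable_mkcond _ _ _ mu _ (EFin \o f) (measurable_itv `[_, _])).1.
  apply: continuous_compact_integrable; first exact: segment_compact.
  by apply: continuous_subspaceT => ?; exact: cf.
pose F t := rho * step (rho^-1 * t - rho^-1 * u).
have dF (t : R) : is_derive t 1 F (f t).
  have dl : is_derive t 1 (fun t : R => rho^-1 * t - rho^-1 * u) rho^-1.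
    apply: is_derive_eq (is_deriveB (is_deriveZ rho^-1 (is_derive_id t 1))
      (is_derive_cst (rho^-1 * u) t 1)) _.
    by rewrite subr0 -[_ *: _]/(_ * _) mulr1.
  apply: is_derive_eq (is_deriveZ rho (is_derive1_comp (is_derive_step _) dl)) _.
  by rewrite -[_ *: _]/(_ * _) mulrCA divff ?mulr1// gt_eqF.
have cF : continuous F.
  by move=> t; apply: differentiable_continuous; apply/derivable1_diffP; have [] := dF t.
transitivity (\int[mu]_(t in `[(u - rho)%R, (u + 2 * rho)%R]) (f t)%:E)%E.
  by rewrite [RHS]integral_mkcond E.
rewrite (@continuous_FTC2 _ f F).
- rewrite /F -!mulrBr -EFinB (step_le0 (t := _ * (u - rho - u))); last first.
    by rewrite mulr_ge0_le0// ?ltW//; lra.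
  rewrite step_ge1 ?mulr0 ?subr0//.
  by rewrite mulrC ler_pdivlMr//; lra.
- lra.
- by apply: continuous_subspaceT => ?; exact: cf.
- split.
  + by move=> t _; have [] := dF t.
  + exact: cvg_at_right_filter (cF _).
  + exact: cvg_at_left_filter (cF _).
- by move=> t _; rewrite derive1E; have [_ ->] := dF t.
Qed.

End flat.

(** * Test functions *)

Section smooth.
Context {R : realType} {N : nat}.
Implicit Types (f g : 'rV[R]_N -> R) (v x z : 'rV[R]_N).

(** A class described by its generators, large enough for the tubes below and closed under
    directional derivatives; this yields derivatives of every order without handling them
    explicitly. *)
Inductive smooth : ('rV[R]_N -> R) -> Prop :=
| smooth_cst c : smooth (fun=> c)
| smooth_flat n a c j : smooth (fun z => flat n (a * z 0 j + c))
| smooth_step a c j : smooth (fun z => step (a * z 0 j + c))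
| smooth_add f g : smooth f -> smooth g -> smooth (fun z => f z + g z)
| smooth_mul f g : smooth f -> smooth g -> smooth (fun z => f z * g z).

Lemma eq_smooth f g : smooth g -> f =1 g -> smooth f.
Proof. by move=> sg /funext ->. Qed.

Lemma is_derive_affine_coord (a c : R) j v x :
  is_derive x v (fun z : 'rV[R]_N => a * z 0 j + c) (a * v 0 j).
Proof.
have cv : h^-1 *: ((a * (h *: v + x) 0 j + c) - (a * x 0 j + c)) @[h --> 0^'] -->
    a * v 0 j.
  apply: cvg_near_cst; near=> h.
  have h0 : h != 0 by near: h; exact: nbhs_dnbhs_neq.
  by rewrite !mxE -[_ *: _]/(_ * _); field.
apply: DeriveDef; first by apply/cvg_ex; exists (a * v 0 j).
by rewrite /derive; apply/cvg_lim.
Unshelve. all: by end_near. Qed.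

Lemma differentiable_affine_coord (a c : R) j x :
  differentiable (fun z : 'rV[R]_N => a * z 0 j + c) x.
Proof.
apply: differentiableD; last exact: differentiable_cst.
by apply: differentiableM; [exact: differentiable_cst|exact: differentiable_coord].
Qed.

Lemma derive_comp_affine_coord (h dh : R -> R) (a c : R) j v x :
  (forall t : R, is_derive t 1 h (dh t)) ->
  differentiable (fun z : 'rV[R]_N => h (a * z 0 j + c)) x /\
  'D_v (fun z : 'rV[R]_N => h (a * z 0 j + c)) x = a * v 0 j * dh (a * x 0 j + c).
Proof.
move=> hdh; pose l := fun z : 'rV[R]_N => a * z 0 j + c.
have dl : differentiable l x := differentiable_affine_coord a c j x.
have dhl : differentiable h (l x).
  by apply/derivable1_diffP; have [] := hdh (l x).
rewrite -/(h \o l); split; first exact: differentiable_comp.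
rewrite deriveE; last exact: differentiable_comp.
rewrite diff_comp//= diff1E// -deriveE// derive1E.
have [_ ->] := hdh (l x); have [_ ->] := is_derive_affine_coord a c j v x.
by [].
Qed.

(** By induction on the construction: derivatives of [flat] are combinations of [flat], the
    derivative of [step] is [hat], a product of two [flat 0], and sums and products follow the usual
    rules. *)
Lemma smooth_diff f : smooth f ->
  (forall x, differentiable f x) /\ forall v, smooth (fun x => 'D_v f x).
Proof.
elim=> [c|n a c j|a c j|f1 g1 _ [df1 sf1] _ [dg1 sg1]|f1 g1 s1 [df1 sf1] s2 [dg1 sg1]].
- split=> [x|v]; first exact: differentiable_cst.
  apply: (@eq_smooth _ (fun=> 0)); first exact: smooth_cst.
  by move=> x; exact: derive_cst.
- have D v x := derive_comp_affine_coord a c j v x (is_derive_flat n).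
  split=> [x|v]; first by have [] := D 0 x.
  apply: (@eq_smooth _ (fun x => (a * v 0 j) *
    (flat n.+2 (a * x 0 j + c) + (- n%:R) * flat n.+1 (a * x 0 j + c)))).
    apply: smooth_mul; first exact: smooth_cst.
    apply: smooth_add; first exact: smooth_flat.
    by apply: smooth_mul; [exact: smooth_cst|exact: smooth_flat].
  by move=> x; have [_ ->] := D v x; rewrite mulNr.
- have D v x := derive_comp_affine_coord a c j v x is_derive_step.
  split=> [x|v]; first by have [] := D 0 x.
  apply: (@eq_smooth _ (fun x => (a * v 0 j) *
    (flat 0 (a * x 0 j + c) * flat 0 (- a * x 0 j + (1 - c))))).
    apply: smooth_mul; first exact: smooth_cst.
    by apply: smooth_mul; exact: smooth_flat.
  move=> x; have [_ ->] := D v x.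
  by rewrite /hat; congr (_ * (_ * flat _ _)); ring.
- split=> [x|v]; first exact: differentiableD.
  apply: (@eq_smooth _ (fun x => 'D_v f1 x + 'D_v g1 x)).
    exact: smooth_add.
  by move=> x; apply: deriveD; exact: diff_derivable.
- split=> [x|v]; first exact: differentiableM.
  apply: (@eq_smooth _ (fun x => f1 x * 'D_v g1 x + g1 x * 'D_v f1 x)).
    by apply: smooth_add; apply: smooth_mul.
  by move=> x; apply: deriveM; exact: diff_derivable.
Qed.

Lemma smooth_prod (I : Type) (l : seq I) (P : pred I) (F : I -> 'rV[R]_N -> R) :
  (forall i, smooth (F i)) -> smooth (fun z => \prod_(i <- l | P i) F i z).
Proof.
move=> sF; elim: l => [|i l IH].
  apply: (@eq_smooth _ (fun=> 1)); first exact: smooth_cst.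
  by move=> z; rewrite big_nil.
case Pi : (P i).
  apply: (@eq_smooth _ (fun z => F i z * \prod_(i <- l | P i) F i z)).
    exact: smooth_mul.
  by move=> z; rewrite big_cons Pi.
apply: (eq_smooth IH).
by move=> z; rewrite big_cons Pi.
Qed.

Lemma smooth_hat (a c : R) j : smooth (fun z => hat (a * z 0 j + c)).
Proof.
apply: (@eq_smooth _ (fun z => flat 0 (a * z 0 j + c) * flat 0 (- a * z 0 j + (1 - c)))).
  by apply: smooth_mul; exact: smooth_flat.
by move=> z; rewrite /hat; congr (_ * flat _ _); ring.
Qed.

Lemma smooth_iterD f vs : smooth f -> smooth (Defs.iterD vs f).
Proof.
move=> sf; elim: vs => [//|v vs IH] /=.
by have [_ /(_ v)] := smooth_diff IH.
Qed.

Lemma test_function_smooth f (M : R) : smooth f ->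
  (forall z, f z != 0 -> `|z| <= M) -> test_function f.
Proof.
move=> sf fM; split.
  by move=> vs x; have [] := smooth_diff (smooth_iterD vs sf).
have sub : closure [set x | f x != 0] `<=` [set x | `|x| <= M].
  have cB : closed [set x : 'rV[R]_N | `|x| <= M].
    apply: (@preimage_closed _ _ (fun x : 'rV[R]_N => `|x|) [set t | t <= M]).
      by move=> x _; exact: norm_continuous.
    exact: closed_le.
  by rewrite closureE; apply: smallest_sub => // x /fM.
apply: bounded_closed_compact; last exact: closed_closure.
exists M; split; first exact: num_real.
by move=> M' MM' x /sub /= /le_trans; apply; exact: ltW.
Qed.

Lemma derive_invariant f v x : (forall h, f (h *: v + x) = f x) -> 'D_v f x = 0.
Proof.
move=> fh; rewrite /derive; apply/cvg_lim => //.
by apply: cvg_near_cst; near=> h; rewrite /= fh subrr scaler0.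
Unshelve. all: by end_near. Qed.

(** * Tubes joining two points on a line parallel to an axis *)

Variables (i : 'I_N) (u v : 'rV[R]_N) (k rho : R).
Hypothesis uv : forall j, j != i -> u 0 j = v 0 j.

(** A bump on the cube of side [rho] having [w] as its lowest corner, not its centre. *)
Definition box_hat (w z : 'rV[R]_N) : R :=
  \prod_(j < N) hat (rho^-1 * z 0 j - rho^-1 * w 0 j).

(* Its partial derivative in direction i is a multiple of the difference of two
   bumps, one near u and one near v. *)
Definition tube (z : 'rV[R]_N) : R :=
  k * (step (rho^-1 * z 0 i - rho^-1 * u 0 i) -
         step (rho^-1 * z 0 i - rho^-1 * v 0 i)) *
  \prod_(j < N | j != i) hat (rho^-1 * z 0 j - rho^-1 * u 0 j).

Lemma smooth_tube : smooth tube.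
Proof.
apply: smooth_mul; last first.
  by apply: smooth_prod => j; exact: smooth_hat.
apply: smooth_mul; first exact: smooth_cst.
apply: (@eq_smooth _ (fun z => step (rho^-1 * z 0 i + - (rho^-1 * u 0 i)) +
  (-1) * step (rho^-1 * z 0 i + - (rho^-1 * v 0 i)))).
  apply: smooth_add; first exact: smooth_step.
  by apply: smooth_mul; [exact: smooth_cst|exact: smooth_step].
by move=> z; rewrite mulN1r.
Qed.

(** Only the [step] factors depend on coordinate [i], and they differentiate to [hat]. As [u] and
    [v] agree elsewhere, the common cross-section completes each term to a full bump. *)
Lemma partial_tube z : partial i tube z = k * rho^-1 * (box_hat u z - box_hat v z).
Proof.
rewrite /partial.
pose T (w z : 'rV[R]_N) := step (rho^-1 * z 0 i + - (rho^-1 * w 0 i)).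
pose P (z : 'rV[R]_N) := \prod_(j < N | j != i) hat (rho^-1 * z 0 j - rho^-1 * u 0 j).
pose e : 'rV[R]_N := unitv i.
have sT w : smooth (T w) by exact: smooth_step.
have sP : smooth P by apply: smooth_prod => j; exact: smooth_hat.
have der f : smooth f -> derivable f z e.
  by move=> /smooth_diff[df _]; exact: diff_derivable.
have DP : 'D_e P z = 0.
  apply: derive_invariant => h; apply: eq_bigr => j ji.
  by rewrite !mxE (negbTE ji) andbF mulr0 add0r.
have DT w : 'D_e (T w) z = rho^-1 * hat (rho^-1 * z 0 i - rho^-1 * w 0 i).
  have [_ ->] := derive_comp_affine_coord rho^-1 (- (rho^-1 * w 0 i)) i e z is_derive_step.
  by rewrite /e !mxE !eqxx mulr1.
have -> : tube = (k *: (T u - T v)) * P by [].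
rewrite deriveM; last 2 first.
- by apply: derivableZ; apply: derivableB; exact: der.
- exact: der.
rewrite DP scaler0 add0r deriveZ; last by apply: derivableB; exact: der.
rewrite deriveB; try exact: der.
rewrite !DT -![_ *: _]/(_ * _) -mulrBr.
have Eu : box_hat u z = hat (rho^-1 * z 0 i - rho^-1 * u 0 i) * P z.
  by rewrite /box_hat (bigD1 i).
have Ev : box_hat v z = hat (rho^-1 * z 0 i - rho^-1 * v 0 i) * P z.
  rewrite /box_hat (bigD1 i)//=; congr (_ * _); apply: eq_bigr => j ji.
  by rewrite uv.
by rewrite Eu Ev; ring.
Qed.

Lemma box_hat_ge0 w z : 0 <= box_hat w z.
Proof. by apply: prodr_ge0 => j _; exact: hat_ge0. Qed.

Lemma hat_scaled_neq0 (a t : R) : 0 < rho -> hat (rho^-1 * t - rho^-1 * a) != 0 ->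
  a < t < a + rho.
Proof.
move=> rho0; apply: contraR; rewrite negb_and -!leNgt => h; apply/eqP.
apply: hat_eq0; rewrite -mulrBr; apply/orP; case/orP: h => h; [left|right].
  by rewrite mulr_ge0_le0 ?invr_ge0 ?(ltW rho0)//; lra.
by rewrite mulrC ler_pdivlMr// mul1r; lra.
Qed.

Lemma box_hat_neq0 w z : 0 < rho -> box_hat w z != 0 -> `|z - w| <= rho.
Proof.
move=> rho0 /prodf_neq0 H; apply: rV_norm_le => [|j]; first exact: ltW.
have /andP[h1 h2] := hat_scaled_neq0 rho0 (H j isT).
by rewrite !mxE ler_norml; apply/andP; split; lra.
Qed.

Lemma tube_le z : 0 < rho -> 0 <= k -> `|tube z| <= k * step 1.
Proof.
move=> rho0 k0; rewrite /tube -mulrA normrM (ger0_norm k0) ler_wpM2l//.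
rewrite normrM -[leRHS]mulr1; apply: ler_pM => //.
  set a := step _; set b := step _.
  have : 0 <= a <= step 1 by rewrite step_ge0 step_le_step1.
  have : 0 <= b <= step 1 by rewrite step_ge0 step_le_step1.
  move=> /andP[? ?] /andP[? ?].
  by rewrite ler_norml; apply/andP; split; lra.
rewrite normr_prod; apply: prodr_ile1 => j _.
by rewrite normr_ge0 ger0_norm ?hat_ge0// hat_le1.
Qed.

Lemma tube_neq0 (x : 'rV[R]_N) (r : R) z : 0 < rho ->
  (forall j, `|u 0 j - x 0 j| <= r) -> (forall j, `|v 0 j - x 0 j| <= r) ->
  tube z != 0 -> `|z - x| <= r + rho.
Proof.
move=> rho0 ur vr; rewrite /tube mulf_eq0 mulf_eq0 !negb_or => /andP[/andP[_ hi] hP].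
have r0 : 0 <= r := le_trans (normr_ge0 _) (ur i).
apply: rV_norm_le => [|j]; first by rewrite addr_ge0 ?(ltW rho0).
have := ur j; have := vr j; rewrite !mxE !ler_norml => /andP[v1 v2] /andP[u1 u2].
have [->{j u1 u2 v1 v2}|ji] := eqVneq j i; last first.
  have /prodf_neq0/(_ j ji)/(hat_scaled_neq0 rho0)/andP[h1 h2] := hP.
  by apply/andP; split; lra.
have := ur i; have := vr i; rewrite !ler_norml => /andP[v1 v2] /andP[u1 u2].
have rV0 : 0 <= rho^-1 by rewrite invr_ge0 ltW.
(* Before both ends the two steps vanish; beyond both ends they both equal [step 1] and cancel. *)
apply: contraNT hi => /nandP[|]; rewrite -ltNge => h; rewrite -!mulrBr subr_eq0.
  by rewrite !step_le0// mulr_ge0_le0//; lra.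
by rewrite (step_ge1 (t := _ * (_ - u 0 i))) ?(step_ge1 (t := _ * (_ - v 0 i)))//
  mulrC ler_pdivlMr// mul1r; lra.
Qed.

End smooth.

(** * The fractional case *)

Section hoelder_pairs.
Context {R : realType} {N : nat}.
Implicit Types (phi : 'rV[R]_N -> R) (q : 'rV[R]_N * 'rV[R]_N).

(** Since the sup-norm gap is at most the Euclidean distance, for [alpha >= 0] this contains every
    pair of distinct points with Hoelder quotient at least [eps]. *)
Definition steep_pairs phi (alpha eps : R) : set ('rV[R]_N * 'rV[R]_N) :=
  [set q | 0 < gap q /\ eps * gap q `^ alpha <= `|phi q.1 - phi q.2|].

(** At scale [delta * r] an [alpha]-Hoelder function with constant [H] then oscillates by at most
    [eps * r ^ alpha]; the cap 1/4 keeps boxes of that size small compared with [r]. *)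
Lemma exists_small_delta (H eps alpha : R) : 0 < H -> 0 < eps -> 0 < alpha ->
  exists2 delta, 0 < delta <= 4^-1 & H * delta `^ alpha <= eps.
Proof.
move=> H0 eps0 al0; pose d := (eps / H) `^ alpha^-1.
have d0 : 0 < d by rewrite powR_gt0// divr_gt0.
exists (Num.min d 4^-1).
  by rewrite lt_min d0 invr_gt0 ltr0n/= ge_min lexx orbT.
rewrite mulrC -ler_pdivlMr//.
have -> : eps / H = d `^ alpha.
  by rewrite /d -powRrM mulVf ?gt_eqF// powRr1// divr_ge0// ltW.
rewrite ge0_ler_powR ?(ltW al0)// ?nnegrE ?(ltW d0)// ?ge_min ?lexx//.
by rewrite le_min (ltW d0) invr_ge0 ler0n.
Qed.

(* On the product of the two boxes of side comparable to the gap, the integrand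
   of the Gagliardo seminorm is at least a constant times gap ^- (2 N). *)
Lemma gagliardo_bounded_steep (s p H eps : R) phi :
  0 < s -> 1 < p -> N%:R < s * p -> 0 < H -> 0 < eps ->
  (forall x y, `|phi x - phi y| <= H * `|x - y| `^ alpha_sp N s p) ->
  (gagliardo_seminorm s p phi < +oo)%E ->
  exists a b M, 0 < a /\ forall q, steep_pairs phi (alpha_sp N s p) eps q ->
    a <= gap q <= b /\ `|q.1| <= M.
Proof.
move=> s0 p1 Nsp H0 eps0 phiH Efin.
have p0 : 0 < p := lt_trans ltr01 p1.
set alpha := alpha_sp N s p in phiH *.
have alp : alpha * p = s * p - N%:R by rewrite mulrBl divfK ?gt_eqF.
have al0 : 0 < alpha by rewrite -(pmulr_lgt0 _ p0) alp subr_gt0.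
(* Moving each endpoint within its box costs at most a quarter of [eps], which leaves one half. *)
have [delta /andP[d0 d4] Hd] := exists_small_delta H0 (divr_gt0 eps0 (ltr0n _ 4)) al0.
pose K : R := Num.sqrt N%:R + 1.
have K0 : 0 < K by rewrite ltr_wpDl// sqrtr_ge0.
pose E := N%:R + s * p.
have E0 : 0 < E by rewrite ltr_wpDl// mulr_gt0.
pose F (z : 'rV[R]_N * 'rV[R]_N) :=
  (`|phi z.1 - phi z.2| `^ p) / (enorm (z.1 - z.2) `^ E).
pose W q (z : 'rV[R]_N * 'rV[R]_N) :=
  2^-1 * (box q.1 (delta * gap q) z.1 * box q.2 (delta * gap q) z.2).
pose I (f : 'rV[R]_N * 'rV[R]_N -> \bar R) :=
  integral_Rn (fun x => integral_Rn (fun y => f (x, y))).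
have gap_ge0 q : 0 <= gap q by exact: normr_ge0.
have dg0 q : 0 <= delta * gap q by rewrite mulr_ge0// ltW.
have WE q z : W q z = 2^-1 *
    ((`|z.1 - q.1| <= delta * gap q) && (`|z.2 - q.2| <= delta * gap q))%R%:R.
  by rewrite /W !boxE// -natrM mulnb.
have near_gap q z : `|z.1 - q.1| <= delta * gap q -> `|z.2 - q.2| <= delta * gap q ->
    gap q / 2 <= `|z.1 - z.2| <= 3 / 2 * gap q.
  move=> h1 h2; have dq : delta * gap q <= 4^-1 * gap q by rewrite ler_wpM2r.
  have e : z.1 - z.2 = (q.1 - q.2) + ((z.1 - q.1) - (z.2 - q.2)).
    by rewrite opprB [RHS]addrC addrACA subrK [q.2 - z.2]addrC addrK.
  have h3 := ler_normB (z.1 - q.1) (z.2 - q.2).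
  have h4 := ler_normD (q.1 - q.2) ((z.1 - q.1) - (z.2 - q.2)).
  have h5 := lerB_normD (q.1 - q.2) ((z.1 - q.1) - (z.2 - q.2)).
  by rewrite e; apply/andP; split; move: h4 h5; rewrite -/(gap q); lra.
pose c0 := (eps / 2) `^ p / (K * (3 / 2)) `^ E.
have c00 : 0 < c0 by rewrite divr_gt0// powR_gt0 ?divr_gt0// ?mulr_gt0.
have F0 z : 0 <= F z by rewrite divr_ge0// powR_ge0.
have FW q z : steep_pairs phi alpha eps q ->
    c0 / (gap q ^+ (N + N)) / 2 *
      (box q.1 (delta * gap q) z.1 * box q.2 (delta * gap q) z.2) <= F z * W q z.
  move=> [g0 qs]; rewrite WE !boxE// -natrM mulnb.
  case: (boolP (_ && _)) => [/andP[z1 z2]|]; last by rewrite !mulr0.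
  rewrite !mulr1 ler_pM2r// ?invr_gt0//.
  have /andP[n1 n2] := near_gap q z z1 z2.
  have phiz : eps / 2 * gap q `^ alpha <= `|phi z.1 - phi z.2|.
    have B (x y : 'rV[R]_N) : `|x - y| <= delta * gap q ->
        `|phi x - phi y| <= eps / 4 * gap q `^ alpha.
      move=> xy; apply: le_trans (phiH x y) _.
      apply: (@le_trans _ _ (H * (delta * gap q) `^ alpha)).
        by rewrite ler_wpM2l ?(ltW H0)// ge0_ler_powR ?nnegrE ?(ltW al0).
      by rewrite powRM ?(ltW d0)// mulrA ler_wpM2r ?powR_ge0.
    have h1 := B _ _ z1; have h2 := B _ _ z2.
    have e : phi q.1 - phi q.2 = (phi z.1 - phi z.2) - (phi z.1 - phi q.1) +
        (phi z.2 - phi q.2) by ring.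
    have h3 := ler_normD ((phi z.1 - phi z.2) - (phi z.1 - phi q.1)) (phi z.2 - phi q.2).
    have h4 := ler_normB (phi z.1 - phi z.2) (phi z.1 - phi q.1).
    by move: qs; rewrite e; lra.
  have en0 : 0 < enorm (z.1 - z.2).
    by apply: lt_le_trans (rV_norm_le_enorm _); apply: lt_le_trans n1; rewrite divr_gt0.
  have en1 : enorm (z.1 - z.2) <= K * (3 / 2) * gap q.
    apply: le_trans (enorm_le_rV_norm _) _; rewrite -mulrA.
    by apply: ler_pM => //; rewrite lerDl.
  rewrite /F; apply: (@le_trans _ _
      ((eps / 2 * gap q `^ alpha) `^ p / (K * (3 / 2) * gap q) `^ E)).
    rewrite powRM ?powR_ge0 ?divr_ge0 ?(ltW eps0)// [(K * _ * _) `^ _]powRM ?(ltW g0)//; last first.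
      by rewrite mulr_ge0 ?(ltW K0).
    rewrite /c0 invfM mulrACA ler_wpM2l ?divr_ge0 ?powR_ge0//.
    (* The exponents of the gap combine to [alpha * p - E = - 2 N]. *)
    rewrite -powRrM alp -powRB; last by rewrite (gt_eqF g0) /= implybT.
    rewrite /E (_ : s * p - N%:R - _ = - (N + N)%:R); last by rewrite natrD; ring.
    by rewrite powR_invn// ltW.
  apply: ler_pM.
  - exact: powR_ge0.
  - by rewrite invr_ge0 powR_ge0.
  - by rewrite ge0_ler_powR ?nnegrE ?(ltW p0)// mulr_ge0 ?powR_ge0 ?divr_ge0 ?(ltW eps0).
  - rewrite lef_pV2 ?posrE ?powR_gt0//; last by rewrite !mulr_gt0.
    by rewrite ge0_ler_powR ?nnegrE ?(ltW E0) ?(ltW en0)// !mulr_ge0 ?(ltW K0).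
(* The product of the two boxes has volume (2 [delta] gap)^(2N), which cancels the gap, so the
   captured energy is the same for all pairs. *)
apply: (@bounded_of_energy R 'rV[R]_N _ I F _ W (c0 / 2 * ((2 * delta) ^+ (N + N)))).
- by move=> f f0; apply: integral_Rn_ge0 => x; apply: integral_Rn_ge0 => y.
- by move=> f g fg; apply: le_integral_Rn => x; apply: le_integral_Rn => y.
- move=> f g f0 g0.
  apply: le_trans (integral_Rn_superadd _ _) _ => [x|x|]; try exact: integral_Rn_ge0.
  by apply: le_integral_Rn => x; exact: integral_Rn_superadd.
- exact: F0.
- have := Efin; rewrite /gagliardo_seminorm => /lty_poweRy; apply.
  by rewrite invr_neq0// gt_eqF.
- by move=> q [].
- move=> q z; rewrite WE.
  case: ((`|z.1 - q.1| <= delta * gap q) && (`|z.2 - q.2| <= delta * gap q)).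
    by rewrite mulr1 lexx invr_ge0 ler0n.
  by rewrite mulr0 lexx invr_ge0 ler0n.
- by apply: mulr_gt0; [exact: divr_gt0|apply: exprn_gt0; exact: mulr_gt0].
- move=> q qs; have [g0 _] := qs.
  have gn0 : gap q != 0 by rewrite gt_eqF.
  pose k := c0 / gap q ^+ (N + N) / 2.
  apply: (@le_trans _ _ (I (fun z => (k * (box q.1 (delta * gap q) z.1 *
                                     box q.2 (delta * gap q) z.2))%:E))); last first.
    apply: le_integral_Rn => x; apply: le_integral_Rn => y.
    by rewrite lee_fin; exact: FW.
  have II (w : 'rV[R]_N) (k' : R) : integral_Rn (fun x => (k' * box w (delta * gap q) x)%:E) =
      (k' * (2 * (delta * gap q)) ^+ N)%:E.
    have := @integral_Rn_prod R N _ (fun=> 2 * (delta * gap q)) k'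
      (fun j => integrable_indic_itv (w 0 j - delta * gap q) (w 0 j + delta * gap q) true false)
      (fun j => integral_indic_centered _ (dg0 q)).
    by rewrite prodr_const card_ord.
  rewrite /I (_ : (fun x => _) = (fun x => ((k * (2 * (delta * gap q)) ^+ N) *
       box q.1 (delta * gap q) x)%:E)).
    rewrite II lee_fin /k !mulrA !exprMn !exprD.
    have gN0 : gap q ^+ N != 0 by rewrite expf_neq0.
    by rewrite le_eqVlt; apply/orP; left; apply/eqP; field.
  apply/funext => x /=; rewrite mulrAC -(II q.2); congr integral_Rn.
  by apply/funext => y; rewrite mulrA.
(* For [L = 4] the supports are disjoint: at a common point the two gaps differ by a factor of at
   most 3, and the first points are within a quarter of the sum of the gaps. *)
- move=> eta eta0; exists 4; first by rewrite ltr0n.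
  move=> q q' [g0 _] [g'0 _] sep z; rewrite !WE.
  case: (boolP (_ && _)) => [/andP[z1 z2]|]; last by rewrite mulr0 ge_min (ltW eta0).
  case: (boolP (_ && _)) => [/andP[z1' z2']|]; last by rewrite mulr0 ge_min (ltW eta0) orbT.
  exfalso.
  have /andP[h1 h2] := near_gap _ _ z1 z2; have /andP[h3 h4] := near_gap _ _ z1' z2'.
  case: sep; [lra|lra|].
  have := ler_distD z.1 q.1 q'.1; rewrite [`|q.1 - z.1|]distrC.
  have : delta * gap q <= 4^-1 * gap q by rewrite ler_wpM2r.
  have : delta * gap q' <= 4^-1 * gap q' by rewrite ler_wpM2r.
  by move: z1 z1'; lra.
Qed.

End hoelder_pairs.

(** * The case s = 1 *)

Section gradient.
Context {R : realType} {N : nat}.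
Implicit Types (phi : 'rV[R]_N -> R) (x y z u v : 'rV[R]_N).
Local Notation mu := (@lebesgue_measure R).

(** The coordinates of [x] are replaced by those of [y] one at a time; one of these [N] moves
    carries at least the average of the total variation. The ends are ordered to make the difference
    nonnegative. *)
Lemma exists_steep_axis_step phi x y : phi x != phi y ->
  exists i u v, [/\ forall j, j != i -> u 0 j = v 0 j,
    forall j, `|u 0 j - x 0 j| <= `|x - y|,
    forall j, `|v 0 j - x 0 j| <= `|x - y| &
    `|phi x - phi y| <= N%:R * (phi u - phi v)].
Proof.
move=> xy; pose w (k : nat) : 'rV[R]_N := \row_(j < N) if (j < k)%N then y 0 j else x 0 j.
have w0 : w 0 = x by apply/rowP => j; rewrite !mxE.
have wN : w N = y by apply/rowP => j; rewrite !mxE ltn_ord.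
have wx k j : `|w k 0 j - x 0 j| <= `|x - y|.
  rewrite !mxE; case: ifP => _; last by rewrite subrr normr0.
  by apply: le_trans (le_coord_rV_norm _ j); rewrite !mxE distrC.
have ww (k j : 'I_N) : j != k -> w k 0 j = w k.+1 0 j.
  by rewrite -val_eqE /= => jk; rewrite !mxE ltnS [(j <= k)%N]leq_eqVlt (negbTE jk).
have tele : phi x - phi y = \sum_(k < N) (phi (w k) - phi (w k.+1)).
  rewrite -(big_mkord xpredT (fun k => phi (w k) - phi (w k.+1))).
  rewrite -[LHS]opprB -w0 -wN -(telescope_sumr (fun k => phi (w k)) (leq0n N)) -sumrN.
  by apply: eq_bigr => k _; rewrite opprB.
have [k hk] : exists k : 'I_N, `|phi x - phi y| <= N%:R * `|phi (w k) - phi (w k.+1)|.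
  apply: contrapT => /forallNP H.
  have N0 : (0 < N)%N.
    rewrite lt0n; apply/negP => /eqP N0; case/eqP: xy; congr phi.
    by rewrite -w0 -wN; congr w.
  have : \sum_(k < N) N%:R * `|phi (w k) - phi (w k.+1)| < \sum_(k < N) `|phi x - phi y|.
    apply: ltr_sum; first by apply/hasP; exists (Ordinal N0); rewrite ?mem_index_enum.
    by move=> k _; rewrite ltNge; apply/negP/H.
  rewrite sumr_const card_ord -mulr_sumr -[X in _ < X]mulr_natl ltr_pM2l ?ltr0n//.
  by rewrite tele ltNge ler_norm_sum.
have [le|le] := leP (phi (w k.+1)) (phi (w k)).
  exists k, (w k), (w k.+1); split=> [j jk|j|j|]; [exact: ww|exact: wx|exact: wx|].
  by move: hk; rewrite [`|phi (w _) - _|]ger0_norm// subr_ge0.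
exists k, (w k.+1), (w k); split=> [j jk|j|j|]; [by rewrite ww|exact: wx|exact: wx|].
by move: hk; rewrite [`|phi (w _) - _|]ler0_norm ?opprB// subr_le0 ltW.
Qed.

(* Testing the weak gradient against a tube joining u to v: the flux is the
   difference of the averages of phi near u and near v. *)
Lemma tube_flux phi (g : 'I_N -> 'rV[R]_N -> R) i u v (k rho A : R) :
  weak_gradient phi g -> 0 < rho -> 0 < k ->
  (forall j, j != i -> u 0 j = v 0 j) -> A <= phi u - phi v ->
  (forall z w, `|z - w| <= rho -> `|phi z - phi w| <= A / 4) ->
  ((k * rho^-1 * (A / 2) * (rho * step 1) ^+ N)%:E <=
   integral_Rn (fun z => `|g i z * tube i u v k rho z|%:E))%E.
Proof.
move=> wg rho0 k0 uv Auv osc.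
have psi : test_function (tube i u v k rho).
  pose r := \sum_j `|v 0 j - u 0 j|.
  have r0 : 0 <= r by apply: sumr_ge0.
  apply: (@test_function_smooth _ _ _ (r + rho + `|u|)); first exact: smooth_tube.
  move=> z /(tube_neq0 (x := u) (r := r) rho0) H.
  rewrite -lerBlDr; apply: le_trans (lerB_dist z u) _; apply: H => j.
    by rewrite subrr normr0.
  by rewrite /r (bigD1 j)//= lerDl sumr_ge0.
have := wg i _ psi; set X := integral_Rn (fun x => (g i x * _)%:E) => wgE.
have c0 : 0 <= k * rho^-1 by rewrite mulr_ge0 ?invr_ge0// ltW.
have low : ((k * rho^-1 * (A / 2) * (rho * step 1) ^+ N)%:E <= - X)%E.
  rewrite -wgE.
  (* On the bump at [u], [phi] is at least [phi u - A / 4], and on the bump at [v] at most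
     [phi v + A / 4]; a difference of at least [A / 2] remains between explicit integrals. *)
  have hint (w : 'rV[R]_N) j := (integral_hat_scaled (w 0 j) rho0).1.
  have hval (w : 'rV[R]_N) j := (integral_hat_scaled (w 0 j) rho0).2.
  have := integral_Rn_prodB (k * rho^-1 * (phi u - A / 4)) (k * rho^-1 * (phi v + A / 4))
    (hint u) (hint v) (hval u) (hval v).
  rewrite prodr_const card_ord => E.
  apply: (@le_trans _ _ ((k / rho * (phi u - A / 4) * (rho * step 1) ^+ N -
       k / rho * (phi v + A / 4) * (rho * step 1) ^+ N)%:E)).
    rewrite lee_fin -mulrBl -mulrBr ler_wpM2r//.
      by rewrite exprn_ge0// mulr_ge0 ?step_ge0// ltW.
    by rewrite ler_wpM2l//; lra.
  rewrite -E; apply: le_integral_Rn => z; rewrite lee_fin partial_tube//.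
  rewrite -/(box_hat rho u z) -/(box_hat rho v z).
  have hu : (phi u - A / 4) * box_hat rho u z <= phi z * box_hat rho u z.
    have [->|h] := eqVneq (box_hat rho u z) 0; first by rewrite !mulr0.
    rewrite ler_wpM2r ?box_hat_ge0//.
    by have := osc _ _ (box_hat_neq0 rho0 h); rewrite ler_norml => /andP[? ?]; lra.
  have hv : phi z * box_hat rho v z <= (phi v + A / 4) * box_hat rho v z.
    have [->|h] := eqVneq (box_hat rho v z) 0; first by rewrite !mulr0.
    rewrite ler_wpM2r ?box_hat_ge0//.
    by have := osc _ _ (box_hat_neq0 rho0 h); rewrite ler_norml => /andP[? ?]; lra.
  rewrite -!(mulrA (k / rho)) -mulrBr mulrCA ler_wpM2l//; lra.
apply: (le_trans low); apply: le_trans (lee_abs _) _; rewrite abseN.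
by apply: le_trans (le_abse_integral_Rn _) _; exact: le_integral_Rn.
Qed.

(** Boxes of very different sizes may be nested, so supports need not be disjoint as in the
    fractional case. The weight also depends on the size of the gradient, and at each point it is
    small for at least one of two separated pairs. *)
Lemma sobolev_bounded_steep (p H eps : R) phi :
  (1 <= N)%N -> 1 < p -> N%:R < p -> 0 < H -> 0 < eps ->
  (forall x y, `|phi x - phi y| <= H * `|x - y| `^ alpha_sp N 1 p) ->
  W1p_seminorm_finite p phi ->
  exists a b M, 0 < a /\ forall q, steep_pairs phi (alpha_sp N 1 p) eps q ->
    a <= gap q <= b /\ `|q.1| <= M.
Proof.
move=> N1 p1 Np H0 eps0 phiH [g [_ [wg Efin]]].
have p0 : 0 < p := lt_trans ltr01 p1.
have N0 : 0 < N%:R :> R by rewrite ltr0n.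
set alpha := alpha_sp N 1 p in phiH *.
have alpE : alpha = 1 - N%:R / p by [].
have al0 : 0 < alpha by rewrite subr_gt0 ltr_pdivrMr// mul1r.
pose G z := enorm (\row_(i < N) g i z).
have G0 z : 0 <= G z by exact: sqrtr_ge0.
have gG i z : `|g i z| <= G z.
  apply: le_trans (rV_norm_le_enorm _); apply: le_trans (le_coord_rV_norm _ i).
  by rewrite mxE.
pose e1 := eps / N%:R.
have e10 : 0 < e1 by rewrite divr_gt0.
have [delta /andP[d0 d4] Hd] := exists_small_delta H0 (divr_gt0 e10 (ltr0n _ 4)) al0.
pose m : R := step 1.
have m0 : 0 < m := step1_gt0.
pose B := 4^-1 * e1 * (delta * m) ^+ N.-1.
have B0 : 0 < B.
  by apply: mulr_gt0; [exact: mulr_gt0|apply: exprn_gt0; exact: mulr_gt0].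
(* With [theta * B = 4 ^+ N], the flux is exactly twice the part lost where the gradient is
   small. *)
pose theta := 4 ^+ N / B.
have th0 : 0 < theta by rewrite divr_gt0// exprn_gt0.
pose beta (q : 'rV[R]_N * 'rV[R]_N) := theta * gap q `^ (N%:R / p).
pose w (t : R) := if 1 <= t then t `^ (1 - p) else 0.
have w0 t : 0 <= w t by rewrite /w; case: ifP => // _; exact: powR_ge0.
have w1 t : w t <= 1.
  rewrite /w; case: ifPn => // t1; rewrite -[leRHS](powRr0 t).
  by apply: ler_powR => //; lra.
pose W (q : 'rV[R]_N * 'rV[R]_N) z := 2^-1 * (box q.1 (2 * gap q) z * w (beta q * G z)).
have gap_ge0 (q : 'rV[R]_N * 'rV[R]_N) : 0 <= gap q by exact: normr_ge0.
have WE q z : W q z = 2^-1 * ((`|z - q.1| <= 2 * gap q)%R%:R * w (beta q * G z)).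
  by rewrite /W boxE// mulr_ge0.
pose F z := G z `^ p.
apply: (@bounded_of_energy R 'rV[R]_N 'rV[R]_N (@integral_Rn R N) F _ W
  (theta `^ (- p) * (4 ^+ N / 2))).
- by move=> f; exact: integral_Rn_ge0.
- by move=> f f'; exact: le_integral_Rn.
- by move=> f f'; exact: integral_Rn_superadd.
- by move=> z; exact: powR_ge0.
- have := Efin; rewrite /Lp_norm_vec => /lty_poweRy; apply.
  by rewrite invr_neq0// gt_eqF.
- by move=> q [].
- move=> q z; rewrite WE; case: (`|z - q.1| <= 2 * gap q) => /=.
    by have := w0 (beta q * G z); have := w1 (beta q * G z); lra.
  by rewrite mul0r mulr0 lexx invr_ge0 ler0n.
- by rewrite mulr_gt0 ?powR_gt0// divr_gt0// exprn_gt0.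
- move=> q [r0 qs]; set r := gap q in r0 qs *.
  have b0 : 0 < beta q by rewrite mulr_gt0// powR_gt0.
  have neq : phi q.1 != phi q.2.
    rewrite -subr_eq0 -normr_gt0; apply: lt_le_trans qs.
    by rewrite mulr_gt0// powR_gt0.
  have [i [u [v [uv ux vx steep]]]] := exists_steep_axis_step neq.
  pose A := e1 * r `^ alpha.
  have Auv : A <= phi u - phi v.
    rewrite /A /e1 mulrAC ler_pdivrMr// [leRHS]mulrC; exact: le_trans steep.
  pose rho := delta * r.
  have rho0 : 0 < rho by rewrite mulr_gt0.
  have osc z z' : `|z - z'| <= rho -> `|phi z - phi z'| <= A / 4.
    move=> zz; apply: le_trans (phiH z z') _.
    apply: (@le_trans _ _ (H * (delta * r) `^ alpha)).
      by rewrite ler_wpM2l ?(ltW H0)// ge0_ler_powR ?nnegrE ?(ltW al0) ?(ltW rho0).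
    by rewrite powRM ?(ltW d0) ?(ltW r0)// mulrA /A [leRHS]mulrAC ler_wpM2r ?powR_ge0.
  (* Normalised so that the tube is bounded by half of [beta q] to the power [1 - p]. *)
  pose k := 2^-1 * beta q `^ (1 - p) / m.
  have k0 : 0 < k by rewrite divr_gt0// mulr_gt0 ?powR_gt0// invr_gt0.
  have flux := tube_flux wg rho0 k0 uv Auv osc.
  pose lam := 2^-1 * beta q `^ (- p).
  have lam0 : 0 <= lam by rewrite mulr_ge0 ?powR_ge0// invr_ge0.
  (* If beta G < 1 then G < 1 / beta; otherwise
     G = beta^(p-1) * G^p * (beta G)^(1-p), and G^p is the energy. *)
  have young z : `|g i z * tube i u v k rho z| <= lam * box q.1 (2 * r) z + F z * W q z.
    rewrite WE boxE ?mulr_ge0 ?(ltW r0)//.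
    have [zT|zT] := boolP (`|z - q.1| <= 2 * gap q); last first.
      (* The tube lies within [r + rho <= 5/4 r] of [q.1], inside the box of radius [2 * r]. *)
      have -> : tube i u v k rho z = 0.
        apply: contraNeq zT => /(tube_neq0 rho0 ux vx) /le_trans; apply.
        have : rho <= 4^-1 * r by rewrite ler_wpM2r// ltW.
        by rewrite -/(gap q) -/r; lra.
      by rewrite mulr0 normr0 mulr0 mul0r !mulr0 addr0.
    rewrite mulr1 mul1r normrM.
    apply: (@le_trans _ _ (G z * (2^-1 * beta q `^ (1 - p)))).
      apply: ler_pM => //; have := tube_le i u v z rho0 (ltW k0).
      by rewrite /k divfK// gt_eqF.
    rewrite /w; case: ifPn => [bG|bG].
      have Gz : 0 < G z by rewrite -(pmulr_rgt0 _ b0); exact: lt_le_trans bG.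
      rewrite [(beta q * _) `^ _]powRM ?(ltW b0)// -[leLHS]add0r; apply: lerD => //.
      rewrite mulrCA [in leRHS]mulrCA ler_wpM2l ?invr_ge0// mulrCA mulrC.
      rewrite ler_wpM2l ?powR_ge0// /F -powRD; last by rewrite (gt_eqF Gz) implybT.
      by rewrite addrC subrK powRr1.
    rewrite !mulr0 addr0 mulrCA ler_wpM2l ?invr_ge0//.
    rewrite powRD; last by rewrite (gt_eqF b0) implybT.
    rewrite powRr1 ?(ltW b0)// mulrA -[leRHS]mul1r ler_wpM2r ?powR_ge0//.
    by rewrite mulrC ltW// ltNge.
  have sub := @integral_Rn_subadd_prod R N
     (fun j => \1_(`[q.1 0 j - 2 * r, q.1 0 j + 2 * r])) (fun=> 2 * (2 * r)) lam
     (fun z => (F z * W q z)%:E) lam0.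
  have {}sub : (integral_Rn (fun z => (lam * box q.1 (2 * r) z)%:E + (F z * W q z)%:E) <=
     (lam * (2 * (2 * r)) ^+ N)%:E + integral_Rn (fun z => (F z * W q z)%:E))%E.
    rewrite -[X in _ ^+ X](card_ord N) -prodr_const; apply: sub.
    - by move=> j; exact: measurable_indic.
    - by move=> j t; rewrite indicE ler0n.
    - by move=> j; apply: integral_indic_centered; rewrite mulr_ge0// ltW.
    - by move=> z; rewrite lee_fin mulr_ge0 ?powR_ge0// WE !mulr_ge0 ?invr_ge0 ?ler0n.
  have young_int : (integral_Rn (fun z => `|g i z * tube i u v k rho z|%:E) <=
      integral_Rn (fun z => (lam * box q.1 (2 * r) z)%:E + (F z * W q z)%:E))%E.
    by apply: le_integral_Rn => z; rewrite -EFinD lee_fin young.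
  have {flux} := le_trans flux (le_trans young_int sub).
  rewrite -leeBlDl// -EFinB; apply: le_trans; rewrite lee_fin.
  (* All powers of r cancel, because alpha = 1 - N / p. *)
  have rN : (r `^ (N%:R / p)) `^ p = r ^+ N.
    by rewrite -powRrM divfK ?gt_eqF// powR_mulrn ?(ltW r0).
  have E1 : lam * (2 * (2 * r)) ^+ N = 2^-1 * theta `^ (- p) * 4 ^+ N.
    rewrite /lam /beta powRM ?(ltW th0) ?powR_ge0// [(r `^ _) `^ - p]powRN rN.
    rewrite mulrA -natrM exprMn.
    have rN0 : r ^+ N != 0 by rewrite expf_neq0// gt_eqF.
    by field.
  have E2 : k / rho * (A / 2) * (rho * m) ^+ N = theta `^ (1 - p) * B.
    rewrite /k /A /B /beta powRM ?(ltW th0) ?powR_ge0//.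
    have -> : (rho * m) ^+ N = (rho * m) * (rho * m) ^+ N.-1.
      by rewrite -exprS prednK.
    rewrite /rho.
    have -> : (delta * r * m) ^+ N.-1 = (delta * m) ^+ N.-1 * r `^ (N%:R - 1).
      rewrite mulrAC exprMn; congr (_ * _).
      by rewrite -powR_mulrn ?(ltW r0)// -subn1 natrB.
    have : (r `^ (N%:R / p)) `^ (1 - p) * (r `^ alpha * r `^ (N%:R - 1)) = 1.
      have e : N%:R / p * (1 - p) + (alpha + (N%:R - 1)) = 0.
        by rewrite alpE; field; rewrite gt_eqF.
      by rewrite -powRrM -!powRD ?(gt_eqF r0) ?implybT// e powRr0.
    have mn : m != 0 by rewrite gt_eqF.
    have rn : r != 0 by rewrite gt_eqF.
    have dn : delta != 0 by rewrite gt_eqF.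
    move: ((r `^ (N%:R / p)) `^ (1 - p)) (r `^ alpha) (r `^ (N%:R - 1))
      (theta `^ (1 - p)) ((delta * m) ^+ N.-1).
    move=> a b c t d abc.
    transitivity (t * (4^-1 * e1 * d) * (a * (b * c))); first by field; rewrite mn rn dn.
    by rewrite abc mulr1.
  rewrite -/m E1 E2.
  have -> : theta `^ (1 - p) = theta * theta `^ (- p).
    by rewrite powRD ?(gt_eqF th0) ?implybT// powRr1// ltW.
  rewrite mulrAC {1}/theta divfK ?gt_eqF//.
  by rewrite le_eqVlt; apply/orP; left; apply/eqP; field.
- move=> eta eta0.
  (* Chosen so that raising [L0] to the power [N / p], and then to [1 - p], gives exactly [eta]. *)
  pose L0 := (eta^-1) `^ (p / (N%:R * (p - 1))).
  have L00 : 0 < L0 by rewrite powR_gt0// invr_gt0.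
  have pm1 : p - 1 != 0 by rewrite subr_eq0 gt_eqF.
  have wL (b b' t : R) : 0 <= t -> L0 `^ (N%:R / p) * b <= b' ->
      1 <= b * t -> w (b' * t) <= eta.
    move=> t0 bb bt; rewrite /w; case: ifP => [b't|_]; last exact: ltW.
    pose l := L0 `^ (N%:R / p).
    have l0 : 0 < l by exact: powR_gt0.
    have lt : l <= b' * t.
      apply: le_trans (_ : l * b * t <= _); last by rewrite ler_wpM2r.
      by rewrite -mulrA ler_peMr// ltW.
    have -> : eta = l `^ (1 - p).
      rewrite /l /L0 -!powRrM (_ : _ * _ = -1); last first.
        by field; rewrite ?pm1 ?gt_eqF.
      by rewrite powR_inv1 ?invrK// invr_ge0 ltW.
    have bt0 : 0 < b' * t := lt_le_trans l0 lt.
    rewrite -[1 - p]opprB !powRN lef_pV2 ?posrE ?powR_gt0 ?invr_gt0//.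
    by rewrite ge0_ler_powR ?nnegrE ?subr_ge0 ?(ltW p1) ?(ltW l0)// (le_trans _ lt)// ltW.
  have Wle q z : W q z <= w (beta q * G z).
    rewrite WE; have := w0 (beta q * G z).
    by case: (`|z - q.1| <= 2 * gap q) => /=; lra.
  (* Where the gradient is below the threshold of the smaller pair, that pair has weight zero;
     elsewhere it is far above the threshold of the larger pair, whose weight has decayed to
     [eta]. *)
  have scale q q' z : 0 < gap q -> L0 * gap q <= gap q' -> Num.min (W q z) (W q' z) <= eta.
    move=> g0 qq'; have [bt|bt] := leP 1 (beta q * G z).
      rewrite ge_min; apply/orP; right; apply: le_trans (Wle _ _) _.
      apply: wL bt => //; rewrite /beta mulrCA ler_wpM2l ?(ltW th0)//.
      rewrite -powRM ?(ltW L00)// ge0_ler_powR ?nnegrE ?divr_ge0 ?(ltW p0)//.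
      by rewrite mulr_ge0// ltW.
    rewrite ge_min; apply/orP; left; apply: le_trans (Wle _ _) _.
    by rewrite /w ifN -?ltNge// ltW.
  (* Boxes of radius twice the gap that meet have centres within twice the sum of the gaps, so 5
     rules out a common point in the third alternative. *)
  exists (Num.max L0 5); first by rewrite lt_max L00.
  move=> q q' [g0 _] [g'0 _] sep z.
  case: sep => [h|h|h].
  + apply: scale => //; apply: le_trans h; rewrite ler_wpM2r// le_max lexx//.
  + rewrite minC; apply: scale => //; apply: le_trans h; rewrite ler_wpM2r// le_max lexx//.
  + rewrite !WE.
    have [z1|_] := boolP (`|z - q.1| <= _); last by rewrite mul0r mulr0 ge_min ltW.
    have [z2|_] := boolP (`|z - q'.1| <= _); last by rewrite mul0r mulr0 ge_min (ltW eta0) orbT.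
    exfalso; have := ler_distD z q.1 q'.1; rewrite [`|q.1 - z|]distrC.
    have : 5 * (gap q + gap q') <= `|q.1 - q'.1|.
      by apply: le_trans h; rewrite ler_wpM2r ?addr_ge0// le_max lexx orbT.
    by lra.
Qed.

End gradient.

(** * Attainment *)

Section quotient.
Context {R : realType} {N : nat}.
Implicit Types (phi : 'rV[R]_N -> R) (x y : 'rV[R]_N).

Lemma continuous_enorm : continuous (@enorm R N).
Proof.
have cS : continuous (fun x : 'rV[R]_N => \sum_(i < N) x 0 i ^+ 2 : R).
  apply: continuous_big => [|i _ x]; first exact: add_continuous.
  by apply: (@cvgM _ _ (nbhs x) _ (fun z => z 0 i) (fun z => z 0 i)); exact: coord_continuous.
by move=> x; apply: continuous_comp; [exact: cS|exact: sqrt_continuous].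
Qed.

Lemma continuous_holder_quot alpha phi (q : 'rV[R]_N * 'rV[R]_N) :
  continuous phi -> 0 < gap q ->
  {for q, continuous (fun q => holder_quot alpha phi q.1 q.2)}.
Proof.
move=> cphi g0; rewrite /holder_quot.
have en0 : 0 < enorm (q.1 - q.2) := lt_le_trans g0 (rV_norm_le_enorm _).
have c1 : q'.1 @[q' --> q] --> q.1 by exact: cvg_fst.
have c2 : q'.2 @[q' --> q] --> q.2 by exact: cvg_snd.
have c3 : enorm (q'.1 - q'.2) @[q' --> q] --> enorm (q.1 - q.2).
  by apply: continuous_cvg (cvgB c1 c2); exact: continuous_enorm.
have cpow : {for enorm (q.1 - q.2), continuous (fun t : R => t `^ alpha)}.
  apply: differentiable_continuous; apply/derivable1_diffP.
  by have [] := is_derive1_powR alpha en0.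
have c4 := continuous_cvg _ cpow c3.
have cp1 := continuous_cvg _ (cphi q.1) c1.
have cp2 := continuous_cvg _ (cphi q.2) c2.
have c5 : `|phi q'.1 - phi q'.2| @[q' --> q] --> `|phi q.1 - phi q.2|.
  by apply: cvg_norm; apply: cvgB; [exact: cp1|exact: cp2].
apply: cvgM; first exact: c5.
by apply: cvgV; [rewrite gt_eqF// powR_gt0|exact: c4].
Qed.

Lemma compact_pairs (a b M : R) :
  compact [set q : 'rV[R]_N * 'rV[R]_N |
    [/\ `|q.1| <= M, `|q.2| <= M + b & a <= gap q]].
Proof.
have cball c : compact [set x : 'rV[R]_N | `|x| <= c].
  apply: bounded_closed_compact.
    exists c; split; first exact: num_real.
    by move=> c' cc' x /= /le_trans; apply; exact: ltW.
  apply: (@preimage_closed _ _ (fun x : 'rV[R]_N => `|x|) [set t | t <= c]).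
    by move=> x _; exact: norm_continuous.
  exact: closed_le.
rewrite (_ : [set q | _] =
  ([set x | `|x| <= M] `*` [set x | `|x| <= M + b]) `&` [set q | a <= gap q]).
  apply: compact_closedI; first exact: compact_setX.
  apply: (@preimage_closed _ _ (@gap R 'rV[R]_N) [set t | a <= t]).
    move=> q _; apply: cvg_norm; apply: cvgB; [exact: cvg_fst|exact: cvg_snd].
  exact: closed_ge.
by apply/seteqP; split=> [q [? ? ?]|q [[? ?] ?]].
Qed.

Lemma holder_quot_le_seminorm alpha phi x y : x != y ->
  ((holder_quot alpha phi x y)%:E <= holder_seminorm alpha phi)%E.
Proof. by move=> xy; apply: ereal_sup_ubound; exists x, y. Qed.

End quotient.

Unset Implicit Arguments.

Theorem theorem5p4 (R : realType) (N : nat) (s p : R)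
  (hN : (1 <= N)%N) (hs0 : 0 < s) (hs1 : s <= 1) (hp1 : 1 < p)
  (hsp : N%:R < s * p)
  (phi : 'rV[R]_N -> R) (hphi : calW s p phi) :
  exists x0 y0 : 'rV[R]_N, x0 != y0 /\
    holder_seminorm (alpha_sp N s p) phi = (holder_quot (alpha_sp N s p) phi x0 y0)%:E.
Proof.
case: hphi => cphi [Hfin [Wlt1 Weq1]].
have p0 : 0 < p := lt_trans ltr01 hp1.
have al0 : 0 < alpha_sp N s p by rewrite subr_gt0 ltr_pdivrMr.
set alpha := alpha_sp N s p in Hfin al0 *.
have quot0 x y : 0 <= holder_quot alpha phi x y by rewrite divr_ge0 ?powR_ge0.
pose e : 'rV[R]_N := const_mx 1.
have e0 : e != 0.
  apply/eqP => /rowP/(_ (Ordinal hN)); rewrite !mxE => /eqP.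
  by rewrite oner_eq0.
have H0 : (0 <= holder_seminorm alpha phi)%E.
  by apply: le_trans (holder_quot_le_seminorm alpha phi e0); rewrite lee_fin.
have Hfn : holder_seminorm alpha phi \is a fin_num by rewrite ge0_fin_numE.
pose H := fine (holder_seminorm alpha phi).
have HE : holder_seminorm alpha phi = H%:E by rewrite fineK.
have quotH x y : x != y -> holder_quot alpha phi x y <= H.
  by move=> xy; rewrite -lee_fin -HE; exact: holder_quot_le_seminorm.
rewrite HE; have : 0 <= H by rewrite -lee_fin -HE.
(* If the seminorm is zero, all quotients vanish and any two distinct points will do. *)
rewrite le_eqVlt => /predU1P[H00|Hgt0].
  exists e, 0; split => //; congr (_%:E); apply/eqP.
  by rewrite eq_le -{1}H00 quot0 quotH.
have en_gt0 (x y : 'rV[R]_N) : x != y -> 0 < enorm (x - y).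
  move=> xy; apply: lt_le_trans (rV_norm_le_enorm _).
  by rewrite normr_gt0 subr_eq0.
pose K : R := Num.sqrt N%:R + 1.
have K0 : 0 < K by rewrite ltr_wpDl// sqrtr_ge0.
have HK0 : 0 < H * K `^ alpha by rewrite mulr_gt0// powR_gt0.
(* The Hoelder bound is restated in the sup norm, at the cost of a factor from the comparison of
   norms. *)
have [C C0 phiH] : exists2 C, 0 < C &
    forall x y, `|phi x - phi y| <= C * `|x - y| `^ alpha.
  exists (H * K `^ alpha) => // x y; have [->|xy] := eqVneq x y.
    by rewrite !subrr !normr0 mulr_ge0 ?powR_ge0 ?(ltW HK0).
  have := quotH _ _ xy; rewrite ler_pdivrMr ?powR_gt0 ?en_gt0// => /le_trans; apply.
  rewrite -mulrA ler_pM2l// -powRM ?(ltW K0)//.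
  rewrite ge0_ler_powR ?nnegrE ?(ltW al0) ?sqrtr_ge0 ?mulr_ge0 ?(ltW K0)//.
  by apply: le_trans (enorm_le_rV_norm _) _; rewrite ler_wpM2r// lerDl.
have H20 : 0 < H / 2 by rewrite divr_gt0.
have [a [b [M [a0 bnd]]]] : exists a b M, 0 < a /\
    forall q, steep_pairs phi alpha (H / 2) q -> a <= gap q <= b /\ `|q.1| <= M.
  move: hs1; rewrite le_eqVlt => /predU1P[s1|s1].
    have alphaE : alpha = alpha_sp N 1 p by rewrite /alpha s1.
    rewrite alphaE in phiH *; rewrite s1 mul1r in hsp.
    by apply: sobolev_bounded_steep C0 H20 phiH _ => //; exact: Weq1.
  by apply: gagliardo_bounded_steep C0 H20 phiH _ => //; exact: Wlt1.
pose A := [set q : 'rV[R]_N * 'rV[R]_N |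
    [/\ `|q.1| <= M, `|q.2| <= M + b & a <= gap q]].
have steepA x y : x != y -> H / 2 <= holder_quot alpha phi x y -> A (x, y).
  move=> xy; rewrite ler_pdivlMr ?powR_gt0 ?en_gt0// => hq.
  have [|/= /andP[ga gb] xM] := bnd (x, y).
    split; first by rewrite normr_gt0 subr_eq0.
    apply: le_trans hq; rewrite /gap/= ler_pM2l// ge0_ler_powR ?nnegrE ?(ltW al0) ?sqrtr_ge0//.
    exact: rV_norm_le_enorm.
  split => //=; rewrite -[y](subKr x); apply: le_trans (ler_normB _ _) _.
  exact: lerD.
(* As [H / 2 < H], the supremum provides a pair in [A]; it makes [A] nonempty, and the maximum over
   [A] is then at least [H / 2], which handles all pairs of smaller quotient. *)
have [x1 [y1 [xy1 q1]]] : exists x y, x != y /\ H / 2 <= holder_quot alpha phi x y.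
  apply: contrapT => nex; have : (H%:E <= (H / 2)%:E)%E.
    rewrite -HE; apply: ge_ereal_sup => _ [x [y [xy ->]]].
    rewrite lee_fin leNgt; apply/negP => hq; apply: nex.
    by exists x, y; split => //; exact: ltW.
  by rewrite lee_fin; lra.
have A1 := steepA _ _ xy1 q1.
have cA : {within A, continuous (fun q => holder_quot alpha phi q.1 q.2)}.
  apply: continuous_in_subspaceT => q /set_mem[_ _ gq].
  exact: continuous_holder_quot (lt_le_trans a0 gq).
have [[x0 y0] /set_mem[/= _ _ g0] maxq] :=
  compact_EVT_max (ex_intro _ _ A1) (@compact_pairs R N a b M) cA.
have xy0 : x0 != y0.
  by rewrite -subr_eq0 -normr_gt0; exact: lt_le_trans g0.
exists x0, y0; split => //; congr (_%:E); apply/eqP; rewrite eq_le quotH// andbT.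
rewrite -lee_fin -HE; apply: ge_ereal_sup => _ [x [y [xy ->]]]; rewrite lee_fin.
have [hq|hq] := leP (H / 2) (holder_quot alpha phi x y).
  by have := maxq (x, y); rewrite /=; apply; rewrite inE; exact: steepA.
apply: le_trans (ltW hq) _; apply: le_trans q1 _.
by have := maxq (x1, y1); rewrite /=; apply; rewrite inE.
Qed.
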